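(* Under the assumptions of the context, with the system in stationarity, let $M^{(c)}$ be the number of type-$c$ customers present (active or inactive). Let $g_j$ denote the type of the customer holding $T_j$ and $G_{c_1,\dots,c_i}(T_1,n_1,\dots,T_i,n_i)=\mathbb P\big(g_j=c_j\ \forall j\le i\mid \text{state}=(T_1,n_1,\dots,T_i,n_i)\big)$ (stationary conditional probability). With $\theta_{c,j}=\lambda_c\mathbf 1\{c\in\mathcal U(\{T_1,\dots,T_j\})\}/\lambda_{\mathcal U(\{T_1,\dots,T_j\})}$ (zero if the denominator vanishes), for complex $|z_c|<1$, $$\mathbb E\Big[\prod_{c}z_c^{M^{(c)}}\Big]=\sum_{i=0}^K\sum_{(T_1,\dots,T_i)}\pi((0))\frac{\Pi_\lambda(\{T_1,\dots,T_i\})}{\Pi_k(T_1,\dots,T_i)}\prod_{j=1}^i\frac1{\eta(j)}\sum_{(n_1,\dots,n_i)\in\mathbb N_0^i}\Big(\sum_{(c_1,\dots,c_i)\in\mathcal C^i}G_{c_1,\dots,c_i}(T_1,n_1,\dots,T_i,n_i)\prod_{j=1}^i z_{c_j}\Big)\prod_{m=1}^{\sum_l n_l}\frac1{\eta(i+m)}\prod_{j=1}^i\Big(\alpha_j\sum_{c}\theta_{c,j}z_c\Big)^{n_j},$$ the sum over tuples running over ordered tuples of distinct tokens.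
   Context: Token-based central queue. There is a finite set $\mathcal C$ of customer types; type-$c$ customers arrive according to independent Poisson processes with rates $\lambda_c>0$. There is a finite set of tokens $\mathcal T=\{t_1,\dots,t_K\}$; each type $c$ has a nonempty set $\mathcal T_c\subseteq\mathcal T$ of compatible tokens, and $\mathcal C_t=\{c: t\in\mathcal T_c\}$. A customer can receive service only while it holds a token (''active''); tokenless customers (''inactive'') wait in a central queue and have departure rate $0$. An arriving type-$c$ customer that finds at least one available token in $\mathcal T_c$ immediately claims one of them according to a randomised assignment rule depending on the set of unavailable tokens and on the type; otherwise it waits. When a customer departs, its token is immediately claimed by the longest-waiting tokenless customer whose type lies in $\mathcal C_t$; if there is none, the token becomes available. State: $(0)$ (empty) or $x=(T_1,n_1,\dots,T_i,n_i)$, with $T_1,\dots,T_i$ the distinct claimed tokens in order of arrival of their holders and $n_j$ the number of tokenless customers that arrived between the holders of $T_j$ and $T_{j+1}$ (after the holder of $T_i$ for $j=i$). For $\mathcal R\subseteq\mathcal T$, $\mathcal U(\mathcal R)=\{c:\mathcal T_c\subseteq\mathcal R\}$, $\lambda_{\mathcal U(\mathcal R)}=\sum_{c\in\mathcal U(\mathcal R)}\lambda_c$; $\lambda_t(\mathcal R)$ is the rate at which arrivals claim token $t\notin\mathcal R$ when $\mathcal R$ is the set of unavailable tokens. Assignment condition: $\prod_{j=1}^i\lambda_{T_j}(\{T_1,\dots,T_{j-1}\})$ is permutation invariant for distinct $T_1,\dots,T_i$; its value is $\Pi_\lambda(\{T_1,\dots,T_i\})$. Order-independent condition: holder of $T_j$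 departs at rate $\eta(\phi(x))s_j(T_1,\dots,T_j)$, $\phi(x)=i+\sum_jn_j$, $s_j\ge0$, $k(T_1,\dots,T_i)=\sum_j s_j(T_1,\dots,T_j)$ permutation invariant and $>0$ for nonempty tuples, $\eta(m)>0$. $\Pi_k(T_1,\dots,T_i)=\prod_{j=1}^ik(T_1,\dots,T_j)$, $\alpha_j=\lambda_{\mathcal U(\{T_1,\dots,T_j\})}/k(T_1,\dots,T_j)$, $0^0=1$. Standing assumptions: both conditions hold, the process is positive recurrent, with stationary distribution $\pi(x)=\pi((0))\frac{\Pi_\lambda(\{T_1,\dots,T_i\})}{\Pi_k(T_1,\dots,T_i)}\prod_{j}\alpha_j^{n_j}\prod_{m=1}^{\phi(x)}\eta(m)^{-1}$. *)

(* Defs.v *)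
From Stdlib Require Import Reals ClassicalEpsilon.
From HB Require Import structures.
From mathcomp Require Import all_boot.
Set Implicit Arguments. Unset Strict Implicit. Unset Printing Implicit Defensive.

Local Open Scope R_scope.

Definition Cx := (R * R)%type.
Definition RtoC (x : R) : Cx := (x, 0).
Definition C0 : Cx := RtoC 0.
Definition C1 : Cx := RtoC 1.
Definition Cadd (a b : Cx) : Cx := (fst a + fst b, snd a + snd b).
Definition Cmul (a b : Cx) : Cx :=
  (fst a * fst b - snd a * snd b, fst a * snd b + snd a * fst b).
Fixpoint Cpow (a : Cx) (n : nat) : Cx :=
  match n with O => C1 | S n' => Cmul a (Cpow a n') end.   (* so 0^0 = 1 *)
Definition Cnorm (a : Cx) : R := sqrt (fst a ^ 2 + snd a ^ 2).

Definition rsum {X} (s : seq X) (f : X -> R) : R := foldr (fun x acc => f x + acc) 0 s.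
Definition rprod {X} (s : seq X) (f : X -> R) : R := foldr (fun x acc => f x * acc) 1 s.
Definition csum {X} (s : seq X) (f : X -> Cx) : Cx := foldr (fun x acc => Cadd (f x) acc) C0 s.
Definition cprod {X} (s : seq X) (f : X -> Cx) : Cx := foldr (fun x acc => Cmul (f x) acc) C1 s.

Definition ser {A : countType} (f : A -> R) (n : nat) : R :=
  match @pickle_inv A n with Some a => f a | None => 0 end.
Definition serC {A : countType} (f : A -> Cx) (n : nat) : Cx :=
  match @pickle_inv A n with Some a => f a | None => C0 end.
(* value of a real series (meaningful when it converges) *)
Definition Rser_val {A : countType} (f : A -> R) : R :=
  epsilon (inhabits 0) (fun l => infinite_sum (ser f) l).
Definition Csummable {A : countType} (f : A -> Cx) : Prop :=
  exists M, forall N, sum_f_R0 (fun n => Cnorm (serC f n)) N <= M.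
Definition Chas_sum {A : countType} (f : A -> Cx) (l : Cx) : Prop :=
  Csummable f /\ infinite_sum (fun n => fst (serC f n)) (fst l)
              /\ infinite_sum (fun n => snd (serC f n)) (snd l).
Definition Csum {A : countType} (f : A -> Cx) : Cx :=
  (Rser_val (fun a => fst (f a)), Rser_val (fun a => snd (f a))).

Section Model.
Context {Ct Tt : finType}.          (* customer types, tokens *)
Variable lam : Ct -> R.             (* arrival rates lambda_c *)
Variable Tc : Ct -> {set Tt}.       (* compatible tokens T_c *)
Variable assign : Ct -> {set Tt} -> Tt -> R.
  (* assign c U t = probability that an arriving type-c customer claims t
     when U is the set of unavailable tokens *)
Variable sfun : seq Tt -> R.        (* s_j(T_1,...,T_j) = sfun [:: T_1; ...; T_j] *)
Variable eta : nat -> R.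

(* detailed state: customers in order of arrival, with type and held token *)
Definition cust := (Ct * option Tt)%type.
Definition dstate := seq cust.

Definition held (s : dstate) : {set Tt} := [set t | Some t \in [seq e.2 | e <- s]].
Definition actv (s : dstate) : seq Tt := pmap (fun e : cust => e.2) s.
Definition hty (s : dstate) : seq Ct := [seq e.1 | e <- s & e.2 != None].
Definition Mc (s : dstate) (c : Ct) : nat := count (fun e : cust => e.1 == c) s.

(* freed token t goes to the longest-waiting tokenless customer with t in T_c *)
Fixpoint give (t : Tt) (s : dstate) : dstate :=
  match s with
  | [::] => [::]
  | e :: s' => if (e.2 == None) && (t \in Tc e.1) then (e.1, Some t) :: s'
               else e :: give t s'
  end.

(* departures: holder at the end of prefix [rcons pre e] leaves at rate
   eta(#customers) * s_j(T_1..T_j), j its rank among active customers *)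
Fixpoint deps (pre s : dstate) (n : nat) : seq (dstate * R) :=
  match s with
  | [::] => [::]
  | e :: s' =>
      (match e.2 with
       | Some t => [:: (give t (pre ++ s'), eta n * sfun (actv (rcons pre e)))]
       | None => [::]
       end) ++ deps (rcons pre e) s' n
  end.

Definition trans (s : dstate) : seq (dstate * R) :=
  let U := held s in
  [seq (rcons s (c, None), lam c) | c <- enum Ct & Tc c \subset U]
  ++ flatten [seq [seq (rcons s (c, Some t), lam c * assign c U t) | t <- enum Tt]
             | c <- enum Ct & ~~ (Tc c \subset U)]
  ++ deps [::] s (size s).

Definition inrate (x y : dstate) : R := rsum (trans x) (fun pr => if pr.1 == y then pr.2 else 0).
Definition outrate (y : dstate) : R := rsum (trans y) (fun pr => pr.2).

Inductive reach : dstate -> Prop :=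
| reach0 : reach [::]
| reachS x y r : reach x -> List.In (y, r) (trans x) -> 0 < r -> reach y.

Definition stationary (p : dstate -> R) : Prop :=
  (forall s, 0 <= p s) /\ (forall s, p s <> 0 -> reach s) /\
  infinite_sum (ser p) 1 /\
  (forall y, infinite_sum (ser (fun x => p x * inrate x y)) (p y * outrate y)).

Definition assign_rule : Prop :=
  (forall c (U : {set Tt}) t, 0 <= assign c U t /\ (assign c U t <> 0 -> t \in Tc c :\: U)) /\
  (forall c (U : {set Tt}), ~~ (Tc c \subset U) -> rsum (enum Tt) (assign c U) = 1).

Definition lamt (U : {set Tt}) (t : Tt) : R := rsum (enum Ct) (fun c => lam c * assign c U t).

Fixpoint prodlam_aux (pre s : seq Tt) : R :=
  match s with
  | [::] => 1
  | t :: s' => lamt [set x in pre] t * prodlam_aux (rcons pre t) s'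
  end.
Definition prodlam (Ts : seq Tt) : R := prodlam_aux [::] Ts.

Definition assignment_condition : Prop :=
  forall s1 s2 : seq Tt, uniq s1 -> perm_eq s1 s2 -> prodlam s1 = prodlam s2.

Definition kfun (Ts : seq Tt) : R := rsum (iota 1 (size Ts)) (fun j => sfun (take j Ts)).

Definition order_independent : Prop :=
  (forall Ts, uniq Ts -> 0 <= sfun Ts) /\
  (forall s1 s2 : seq Tt, uniq s1 -> perm_eq s1 s2 -> kfun s1 = kfun s2) /\
  (forall Ts, uniq Ts -> Ts <> [::] -> 0 < kfun Ts) /\
  (forall m, (0 < m)%N -> 0 < eta m).

Definition PiK (Ts : seq Tt) : R := rprod (iota 1 (size Ts)) (fun j => kfun (take j Ts)).
Definition lamU (U : {set Tt}) : R := rsum (enum Ct) (fun c => if Tc c \subset U then lam c else 0).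
Definition alpha (Ts : seq Tt) (j : nat) : R :=
  lamU [set x in take j Ts] / kfun (take j Ts).
Definition theta (Ts : seq Tt) (c : Ct) (j : nat) : R :=
  let U := [set x in take j Ts] in
  if Req_EM_T (lamU U) 0 then 0 else (if Tc c \subset U then lam c else 0) / lamU U.

(* aggregated state: (number of leading tokenless customers, [(T_1,n_1);...;(T_i,n_i)]);
   the state x = (T_1,n_1,...,T_i,n_i) of the paper is (0, zip Ts ns) *)
Fixpoint agg (s : dstate) : nat * seq (Tt * nat) :=
  match s with
  | [::] => (0%N, [::])
  | e :: s' => let (l, bs) := agg s' in
               match e.2 with Some t => (0%N, (t, l) :: bs) | None => (l.+1, bs) end
  end.

Variable p : dstate -> R.
Definition Prob (E : dstate -> bool) : R := Rser_val (fun s => if E s then p s else 0).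

Definition Gcond (cs : seq Ct) (Ts : seq Tt) (ns : seq nat) : R :=
  let x := (0%N, zip Ts ns) in
  let PX := Prob (fun s => agg s == x) in
  if Req_EM_T PX 0 then 0 else Prob (fun s => (agg s == x) && (hty s == cs)) / PX.

Variable z : Ct -> Cx.

Definition innerTerm (Ts : seq Tt) (ns : seq nat) : Cx :=
  Cmul (Cmul (csum (enum {: (size Ts).-tuple Ct})
                   (fun cs => Cmul (RtoC (Gcond (val cs) Ts ns)) (cprod (val cs) z)))
             (RtoC (rprod (iota 1 (sumn ns)) (fun m => / eta (size Ts + m)%N))))
       (cprod (iota 1 (size Ts))
              (fun j => Cpow (Cmul (RtoC (alpha Ts j))
                                   (csum (enum Ct) (fun c => Cmul (RtoC (theta Ts c j)) (z c))))
                             (nth 0%N ns j.-1))).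

Definition innerSum (Ts : seq Tt) : Cx :=
  Csum (fun ns : (size Ts).-tuple nat => innerTerm Ts ns).

Definition rhs : Cx :=
  csum (iota 0 #|Tt|.+1) (fun i =>
    csum (filter (@uniq Tt) (map (fun Ts : i.-tuple Tt => val Ts) (enum {: i.-tuple Tt}))) (fun Ts : seq Tt =>
      Cmul (RtoC (p [::] * prodlam Ts / PiK Ts * rprod (iota 1 i) (fun j => / eta j)))
           (innerSum Ts))).

Definition lhs_term (s : dstate) : Cx :=
  Cmul (RtoC (p s)) (cprod (enum Ct) (fun c => Cpow (z c) (Mc s c))).

End Model.

(* Main.v *)
From Stdlib Require Import Reals Lra Psatz ClassicalEpsilon FunctionalExtensionality.
From HB Require Import structures.
From mathcomp Require Import all_boot.
Require Import Defs.
Set Implicit Arguments. Unset Strict Implicit. Unset Printing Implicit Defensive.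
Local Open Scope R_scope.

(** Waiting customers are, given the sequence of tokens and the types of their holders,
independent, with laws proportional to the arrival rates of the types compatible with the tokens
ahead of them. The kernel sending such a reduced state (a skeleton) to this product law
intertwines the detailed chain with a chain on skeletons, so the minimal solution of the balance
equations with value 1 at the empty state, obtained by iteration from 0, has this product
structure. Every stationary p dominates p(empty) times the minimal solution; both balance the
flows between consecutive levels (numbers of customers), and as p is summable the difference has
zero net flow across levels, hence vanishes level by level. Summing the minimal solution over the
holder types gives a solution on token sequences that is dominated by the explicit product form;
by the same level-crossing argument the two agree. The generating function then follows by
grouping the detailed states along their finite fibres over (T_1, n_1, ..., T_i, n_i). *)

(** * Finite sums of reals *)

(** The joint law of the holder types has no explicit formula here; only its sum over types does.
    The product structure can therefore not be checked on a formula and has to come from a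
    construction, the iterates. The iteration prescribes the value 1 at the empty state in place of
    the balance equation there, so the difference between [p] and the minimal solution could carry a
    constant net flow across all levels; this is what the summability of [p] excludes. The explicit
    weight on token sequences does satisfy the balance at the empty state, so the second comparison
    meets no such constant and needs no summability. That weight serves twice: as the bound that
    makes the iterates converge, and as the value that the sums over holder types must take.
    Blocking is what makes the kernel work: a waiting customer has all its compatible tokens ahead
    of it, so a freed token can only be claimed behind its former holder, and it passes over
    incompatible customers without changing their weight. *)

HB.instance Definition _ := Monoid.isComLaw.Build R 0 Rplus
  (fun x y z => esym (Rplus_assoc x y z)) Rplus_comm Rplus_0_l.
HB.instance Definition _ := Monoid.isComLaw.Build R 1 Rmult
  (fun x y z => esym (Rmult_assoc x y z)) Rmult_comm Rmult_1_l.
HB.instance Definition _ := Monoid.isMulLaw.Build R 0 Rmult Rmult_0_l Rmult_0_r.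
HB.instance Definition _ := Monoid.isAddLaw.Build R Rmult Rplus
  Rmult_plus_distr_r Rmult_plus_distr_l.

Local Notation "\sum_ ( i <- r ) F" := (\big[Rplus/0]_(i <- r) F) : R_scope.

Lemma rsumE {X} (s : seq X) f : rsum s f = \sum_(x <- s) f x.
Proof. by rewrite unlock. Qed.

Lemma rprodE {X} (s : seq X) f : rprod s f = \big[Rmult/1]_(x <- s) f x.
Proof. by rewrite unlock. Qed.

Lemma sumR_ge0 {X : eqType} (s : seq X) (F : X -> R) :
  (forall x, x \in s -> 0 <= F x) -> 0 <= \sum_(x <- s) F x.
Proof.
move=> h; rewrite big_seq; apply: (big_ind (fun x => 0 <= x)) => //; first lra.
by move=> x y; lra.
Qed.

Lemma sumR_le {X : eqType} (s : seq X) (F G : X -> R) :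
  (forall x, x \in s -> F x <= G x) -> \sum_(x <- s) F x <= \sum_(x <- s) G x.
Proof.
move=> h; rewrite big_seq [X in _ <= X]big_seq.
by apply: (big_ind2 (fun x y => x <= y)) => //; [lra | move=> *; lra].
Qed.

Lemma sumR_mem_le {X : eqType} (s : seq X) (F : X -> R) x :
  (forall x, x \in s -> 0 <= F x) -> x \in s -> F x <= \sum_(x <- s) F x.
Proof.
elim: s => // a s IH h; rewrite inE big_cons => /orP[/eqP->|xs].
  by have := @sumR_ge0 _ s F (fun x (xs : x \in s) => h x (mem_behead (s := a :: s) xs)); lra.
have := IH (fun x (xs : x \in s) => h x (mem_behead (s := a :: s) xs)) xs.
by have := h a (mem_head _ _); lra.
Qed.

Lemma sumR_eq0 {X : eqType} (s : seq X) (F : X -> R) :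
  (forall x, x \in s -> 0 <= F x) -> \sum_(x <- s) F x = 0 -> forall x, x \in s -> F x = 0.
Proof. by move=> h e x xs; have := sumR_mem_le h xs; have := h x xs; lra. Qed.

Lemma sumR_opp {X} (s : seq X) F : \sum_(x <- s) - F x = - \sum_(x <- s) F x.
Proof. by apply: (big_ind2 (fun x y => x = - y)) => // *; lra. Qed.

Lemma sumR_sub {X} (s : seq X) F G :
  \sum_(x <- s) (F x - G x) = \sum_(x <- s) F x - \sum_(x <- s) G x.
Proof. by rewrite /Rminus big_split sumR_opp. Qed.

Lemma sumR_abs {X} (s : seq X) F : Rabs (\sum_(x <- s) F x) <= \sum_(x <- s) Rabs (F x).
Proof.
apply: (big_ind2 (fun x y => Rabs x <= y)); first by rewrite Rabs_R0; lra.
  by move=> x1 x2 y1 y2 h1 h2; have := Rabs_triang x1 y1; lra.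
by move=> *; lra.
Qed.

Lemma sumR_sub_le {X : eqType} (s1 s2 : seq X) F : uniq s1 -> {subset s1 <= s2} ->
  (forall x, 0 <= F x) -> \sum_(x <- s1) F x <= \sum_(x <- s2) F x.
Proof.
elim: s1 s2 => [|a s1 IH] s2 /=.
  by move=> _ _ h; rewrite big_nil; apply: sumR_ge0.
case/andP=> na u1 sub h; have as2 : a \in s2 by apply: sub; rewrite mem_head.
rewrite big_cons (perm_big _ (perm_to_rem as2)) /= big_cons.
suff : \sum_(x <- s1) F x <= \sum_(x <- rem a s2) F x by lra.
apply: IH => // x xs; have /sub : x \in a :: s1 by rewrite inE xs orbT.
rewrite (perm_mem (perm_to_rem as2)) inE => /orP[/eqP ex|//].
by rewrite ex (negbTE na) in xs.
Qed.

Lemma sumR_uniq_pick {X : eqType} (s : seq X) F a : uniq s -> a \in s ->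
  \sum_(x <- s) (if x == a then F x else 0) = F a.
Proof. move=> u i; rewrite (bigD1_seq a) //= eqxx big1 ?Rplus_0_r //.
by move=> x /negbTE ->. Qed.

Lemma sumR_support {X : eqType} (s1 s2 : seq X) F : uniq s1 -> uniq s2 -> {subset s1 <= s2} ->
  (forall x, x \notin s1 -> F x = 0) -> \sum_(x <- s2) F x = \sum_(x <- s1) F x.
Proof.
move=> u1 u2 sub h; rewrite (bigID (mem s1)) /= [X in _ + X]big1; last by move=> i /h.
rewrite Rplus_0_r -big_filter; apply: perm_big; apply: uniq_perm => //.
  exact: filter_uniq.
by move=> x; rewrite mem_filter; case e: (x \in s1) => //=; rewrite sub.
Qed.

(** * Unconditional summation over a countable type *)

(** Convergence along finite subsets does not depend on the enumeration [pickle], so sums over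
    states can be regrouped over tuples, whose enumeration is unrelated. *)
Definition Usum {A : countType} (f : A -> R) (l : R) : Prop :=
  forall eps, 0 < eps -> exists F0 : seq A, forall F : seq A, uniq F -> {subset F0 <= F} ->
    Rabs (\sum_(x <- F) f x - l) < eps.

Definition fstser (A : countType) (N : nat) : seq A := pmap (@pickle_inv A) (iota 0 N.+1).

Lemma mem_fstser (A : countType) N (a : A) : (a \in fstser A N) = (pickle a <= N)%N.
Proof.
rewrite mem_pmap; apply/mapP/idP => [[n]|h].
  rewrite mem_iota add0n ltnS => /= h e.
  by have := @pickle_invK A n; case: (pickle_inv n) e => //= b [->] ->.
by exists (pickle a); rewrite ?mem_iota ?ltnS // pickleK_inv.
Qed.

Lemma fstser_uniq (A : countType) N : uniq (fstser A N).
Proof.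
apply: (pmap_uniq (g := pickle)); last exact: iota_uniq.
by move=> n; apply: pickle_invK.
Qed.

Lemma sum_fstser (A : countType) (f : A -> R) N :
  sum_f_R0 (ser f) N = \sum_(x <- fstser A N) f x.
Proof.
rewrite /fstser; elim: N => [|N IH].
  by rewrite /= /oapp /ser; case: (pickle_inv 0%N) => [a|] /=;
     rewrite ?big_cons ?big_nil //= Rplus_0_r.
rewrite -[N.+2]addn1 iotaD pmap_cat big_cat add0n [sum_f_R0 _ _]/= IH /=; congr (_ + _).
by rewrite /oapp /ser; case: (pickle_inv _) => [a|] /=; rewrite ?big_cons ?big_nil //= Rplus_0_r.
Qed.

Lemma sub_fstser (A : countType) (F : seq A) :
  exists N0, forall N, (N0 <= N)%N -> {subset F <= fstser A N}.
Proof.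
exists (\max_(a <- F) pickle a)%N => N h a aF; rewrite mem_fstser.
by apply: leq_trans h; rewrite (big_rem _ aF) leq_maxl.
Qed.

Lemma Usum_infinite_sum (A : countType) (f : A -> R) l : Usum f l -> infinite_sum (ser f) l.
Proof.
move=> h eps e0; have [F0 hF] := h eps e0; have [N0 hN] := sub_fstser F0.
exists N0 => n /leP hn; rewrite /R_dist sum_fstser.
by apply: hF; [apply: fstser_uniq | apply: hN].
Qed.

Lemma Usum_Rser_val (A : countType) (f : A -> R) l : Usum f l -> Rser_val f = l.
Proof.
move=> /Usum_infinite_sum h; apply: (uniqueness_sum _ _ _ _ h).
by rewrite /Rser_val; apply: epsilon_spec; exists l.
Qed.

Lemma Usum_add (A : countType) (f g : A -> R) a b :
  Usum f a -> Usum g b -> Usum (fun x => f x + g x) (a + b).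
Proof.
move=> hf hg eps e0.
have [F hF] := hf (eps / 2) ltac:(lra); have [G hG] := hg (eps / 2) ltac:(lra).
exists (F ++ G) => H u sub; rewrite big_split /=.
have hlt x y : Rabs (x - a) < eps / 2 -> Rabs (y - b) < eps / 2 ->
    Rabs (x + y - (a + b)) < eps.
  by move=> /Rabs_def2[? ?] /Rabs_def2[? ?]; apply: Rabs_def1; lra.
apply: hlt; [apply: hF | apply: hG] => // x xF; apply: sub; rewrite mem_cat xF ?orbT //.
Qed.

Lemma Usum_scal (A : countType) (f : A -> R) c a : Usum f a -> Usum (fun x => c * f x) (c * a).
Proof.
move=> hf eps e0; have c0 : 0 < Rabs c + 1 by have := Rabs_pos c; lra.
have [F hF] := hf (eps / (Rabs c + 1)) (Rdiv_lt_0_compat _ _ e0 c0).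
exists F => H u sub; rewrite -big_distrr /= -Rmult_minus_distr_l Rabs_mult.
have := hF H u sub; set d := Rabs (_ - a) => hd.
have d0 : 0 <= d by apply: Rabs_pos.
have : (Rabs c + 1) * d < (Rabs c + 1) * (eps / (Rabs c + 1)) by apply: Rmult_lt_compat_l.
have -> : (Rabs c + 1) * (eps / (Rabs c + 1)) = eps by field; lra.
by have := Rabs_pos c; nra.
Qed.

Lemma Usum_finite (A : countType) (f : A -> R) (s : seq A) : uniq s ->
  (forall x, x \notin s -> f x = 0) -> Usum f (\sum_(x <- s) f x).
Proof.
move=> us h eps e0; exists s => F u sub.
by rewrite (sumR_support us u sub h) Rminus_diag Rabs_R0.
Qed.

Lemma Usum_nonneg (A : countType) (f : A -> R) M : (forall x, 0 <= f x) ->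
  (forall F : seq A, uniq F -> \sum_(x <- F) f x <= M) -> exists l, Usum f l.
Proof.
move=> f0 hM; pose E r := exists F : seq A, uniq F /\ r = \sum_(x <- F) f x.
have [|| l [ub lub]] := completeness E.
- by exists M => r [F [u ->]]; apply: hM.
- by exists 0; exists [::]; rewrite big_nil.
exists l => eps e0.
case: (classic (exists F : seq A, uniq F /\ l - eps < \sum_(x <- F) f x)) => [[F [uF hF]]|no].
  exists F => G uG sub; have h1 : \sum_(x <- F) f x <= \sum_(x <- G) f x.
    exact: sumR_sub_le.
  have h2 : \sum_(x <- G) f x <= l by apply: ub; exists G.
  by apply: Rabs_def1; lra.
have : l <= l - eps; last lra.
apply: lub => r [F [u ->]]; apply: Rnot_lt_le => h; apply: no; by exists F.
Qed.

(** [f] is the difference of [g + f] and [g], both nonnegative with bounded finite sums. *)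
Lemma Usum_dominated (A : countType) (f g : A -> R) M : (forall x, Rabs (f x) <= g x) ->
  (forall F : seq A, uniq F -> \sum_(x <- F) g x <= M) -> exists l, Usum f l.
Proof.
move=> fg hM.
have g0 x : 0 <= g x by have := fg x; have := Rabs_pos (f x); lra.
have [a ha] : exists l, Usum (fun x => g x + f x) l.
  apply: (@Usum_nonneg _ _ (2 * M)) => [x|F u].
    by have := fg x; have := Rle_abs (- f x); rewrite Rabs_Ropp; lra.
  apply: Rle_trans (_ : \sum_(x <- F) 2 * g x <= _); last first.
    by rewrite -big_distrr /=; have := hM F u; lra.
  by apply: sumR_le => x _; have := fg x; have := Rle_abs (f x); lra.
have [b hb] := Usum_nonneg g0 hM.
exists (a + -1 * b) => eps e0.
have [F hF] := Usum_add ha (Usum_scal (-1) hb) e0; exists F => G u sub.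
by have := hF G u sub; congr (Rabs (_ - _) < _); apply: eq_bigr => x _; ring.
Qed.

Lemma flatten_fibres_uniq (A B : eqType) (g : A -> option B) (fib : B -> seq A) G :
  (forall b, uniq (fib b)) -> (forall a b, (a \in fib b) = (g a == Some b)) -> uniq G ->
  uniq (flatten [seq fib b | b <- G]).
Proof.
move=> ufib mfib; elim: G => //= b G IH /andP[nb uG]; rewrite cat_uniq ufib IH // andbT.
apply/hasPn => a /flatten_mapP[b' b'G]; rewrite /= !mfib => /eqP ->.
by apply/negP => /eqP[e]; rewrite -e b'G in nb.
Qed.

Lemma Usum_fibres (A B : countType) (f : A -> R) (g : A -> option B) (fib : B -> seq A) l :
  Usum f l -> (forall a, g a = None -> f a = 0) -> (forall b, uniq (fib b)) ->
  (forall a b, (a \in fib b) = (g a == Some b)) ->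
  Usum (fun b => \sum_(a <- fib b) f a) l.
Proof.
move=> hf hn ufib mfib eps e0; have [F0 hF] := hf eps e0.
exists (pmap g F0) => G uG sub.
have uflat := flatten_fibres_uniq ufib mfib uG.
(* Points of [F0] outside the fibres over [G] have no image under [g], so [f] vanishes there: adding
   them makes the set contain [F0] without changing the sum. *)
pose rest := undup [seq a <- F0 | a \notin flatten [seq fib b | b <- G]].
have := hF (flatten [seq fib b | b <- G] ++ rest) _ _.
rewrite big_cat big_flatten big_map /= [X in _ + X]big1_seq; first rewrite Rplus_0_r; last first.
  move=> a /=; rewrite mem_undup mem_filter => /andP[na aF]; apply: hn.
  case e: (g a) => [b|] //; case/negP: na; apply/flatten_mapP; exists b.
    by apply: sub; rewrite mem_pmap -e map_f.
  by rewrite mfib e.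
apply; first by rewrite cat_uniq uflat undup_uniq andbT; apply/hasPn => a;
  rewrite mem_undup mem_filter => /andP[].
move=> a aF; rewrite mem_cat mem_undup mem_filter aF andbT; exact: orbN.
Qed.

Lemma Usum_bigsum (A : countType) (X : eqType) (s : seq X) (f : X -> A -> R) (l : X -> R) :
  (forall i, i \in s -> Usum (f i) (l i)) -> Usum (fun a => \sum_(i <- s) f i a) (\sum_(i <- s) l i).
Proof.
elim: s => [|i s IH] h.
  move=> eps e0; exists [::] => F _ _; rewrite big_nil big1 ?Rminus_diag ?Rabs_R0 //.
  by move=> x _; rewrite big_nil.
rewrite big_cons; have e : (fun a => \sum_(i <- i :: s) f i a) =
  (fun a => f i a + \sum_(i <- s) f i a).
  by apply: functional_extensionality => a; rewrite big_cons.
rewrite e; apply: Usum_add; first exact/h/mem_head.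
by apply: IH => j js; apply: h; rewrite inE js orbT.
Qed.

Lemma sumR_le_infinite_sum (A : countType) (f : A -> R) l (F : seq A) :
  (forall x, 0 <= f x) -> infinite_sum (ser f) l -> uniq F -> \sum_(x <- F) f x <= l.
Proof.
move=> f0 h u; have [N hN] := sub_fstser F.
apply: Rle_trans (sumR_sub_le u (hN N (leqnn N)) f0) _.
rewrite -sum_fstser; apply: sum_incr => // n.
by rewrite /ser; case: pickle_inv => //; lra.
Qed.

(** Used to turn the balance series in [stationary] into sums over finitely many predecessors. *)
Lemma infinite_sum_finite (A : countType) (f : A -> R) l (s : seq A) : uniq s ->
  (forall x, x \notin s -> f x = 0) -> infinite_sum (ser f) l -> l = \sum_(x <- s) f x.
Proof.
move=> u h hl; apply: uniqueness_sum hl _.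
exact/Usum_infinite_sum/Usum_finite.
Qed.

Lemma Un_cv_bigsum X (s : seq X) (u : nat -> X -> R) (l : X -> R) :
  (forall x, Un_cv (fun n => u n x) (l x)) ->
  Un_cv (fun n => \sum_(x <- s) u n x) (\sum_(x <- s) l x).
Proof.
move=> h; elim: s => [|x s IH].
  by move=> e e0; exists 0%N => n _; rewrite !big_nil /R_dist Rminus_diag Rabs_R0.
rewrite big_cons; have -> : (fun n => \sum_(x <- x :: s) u n x) =
   (fun n => u n x + \sum_(x <- s) u n x).
  by apply: functional_extensionality => n; rewrite big_cons.
by apply: CV_plus.
Qed.

(** * Complex numbers *)

Lemma Cadd_assoc : associative Cadd.
Proof. by move=> [a b] [c d] [e f]; rewrite /Cadd /=; congr pair; ring. Qed.
Lemma Cadd_comm : commutative Cadd.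
Proof. by move=> [a b] [c d]; rewrite /Cadd /=; congr pair; ring. Qed.
Lemma Cadd_0_l : left_id C0 Cadd.
Proof. by move=> [a b]; rewrite /Cadd /=; congr pair; ring. Qed.
Lemma Cmul_assoc : associative Cmul.
Proof. by move=> [a b] [c d] [e f]; rewrite /Cmul /=; congr pair; ring. Qed.
Lemma Cmul_comm : commutative Cmul.
Proof. by move=> [a b] [c d]; rewrite /Cmul /=; congr pair; ring. Qed.
Lemma Cmul_1_l : left_id C1 Cmul.
Proof. by move=> [a b]; rewrite /Cmul /=; congr pair; ring. Qed.
Lemma Cmul_0_l : left_zero C0 Cmul.
Proof. by move=> [a b]; rewrite /Cmul /=; congr pair; ring. Qed.
Lemma Cmul_0_r : right_zero C0 Cmul.
Proof. by move=> x; rewrite Cmul_comm Cmul_0_l. Qed.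
Lemma Cmul_add_l : left_distributive Cmul Cadd.
Proof. by move=> [a b] [c d] [e f]; rewrite /Cmul /Cadd /=; congr pair; ring. Qed.
Lemma Cmul_add_r : right_distributive Cmul Cadd.
Proof. by move=> x y z; rewrite Cmul_comm Cmul_add_l !(Cmul_comm x). Qed.

HB.instance Definition _ := Monoid.isComLaw.Build Cx C0 Cadd Cadd_assoc Cadd_comm Cadd_0_l.
HB.instance Definition _ := Monoid.isComLaw.Build Cx C1 Cmul Cmul_assoc Cmul_comm Cmul_1_l.
HB.instance Definition _ := Monoid.isMulLaw.Build Cx C0 Cmul Cmul_0_l Cmul_0_r.
HB.instance Definition _ := Monoid.isAddLaw.Build Cx Cmul Cadd Cmul_add_l Cmul_add_r.

Lemma Cx_semiring : Ring_theory.semi_ring_theory C0 C1 Cadd Cmul eq.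
Proof.
split; [exact: Cadd_0_l | exact: Cadd_comm | exact: Cadd_assoc | exact: Cmul_1_l
  | exact: Cmul_0_l | exact: Cmul_comm | exact: Cmul_assoc | exact: Cmul_add_l].
Qed.
Add Ring Cx_ring : Cx_semiring.

Lemma csumE {X} (s : seq X) f : csum s f = \big[Cadd/C0]_(x <- s) f x.
Proof. by rewrite unlock. Qed.

Lemma cprodE {X} (s : seq X) f : cprod s f = \big[Cmul/C1]_(x <- s) f x.
Proof. by rewrite unlock. Qed.

Lemma RtoC_mul a b : RtoC (a * b) = Cmul (RtoC a) (RtoC b).
Proof. by rewrite /RtoC /Cmul /=; congr pair; ring. Qed.

Lemma RtoC_sum X (s : seq X) F : RtoC (\sum_(x <- s) F x) = \big[Cadd/C0]_(x <- s) RtoC (F x).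
Proof.
apply: (big_morph RtoC) => // a b.
by rewrite /RtoC /Cadd /=; congr pair; ring.
Qed.

Lemma RtoC_prod X (s : seq X) F :
  RtoC (\big[Rmult/1]_(x <- s) F x) = \big[Cmul/C1]_(x <- s) RtoC (F x).
Proof. by apply: (big_morph RtoC) => // a b; apply: RtoC_mul. Qed.

Lemma RtoC_pow a n : RtoC (a ^ n) = Cpow (RtoC a) n.
Proof. by elim: n => //= n <-; rewrite -RtoC_mul. Qed.

Lemma Cpow_mul a b n : Cpow (Cmul a b) n = Cmul (Cpow a n) (Cpow b n).
Proof. by elim: n => [|n /= ->] /=; ring. Qed.

Lemma fst_csum X (s : seq X) F : fst (\big[Cadd/C0]_(x <- s) F x) = \sum_(x <- s) fst (F x).
Proof. exact: (big_morph fst). Qed.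

Lemma snd_csum X (s : seq X) F : snd (\big[Cadd/C0]_(x <- s) F x) = \sum_(x <- s) snd (F x).
Proof. exact: (big_morph snd). Qed.

Lemma fst_RtoC_mul a x : fst (Cmul (RtoC a) x) = a * fst x.
Proof. by rewrite /Cmul /=; ring. Qed.

Lemma snd_RtoC_mul a x : snd (Cmul (RtoC a) x) = a * snd x.
Proof. by rewrite /Cmul /=; ring. Qed.

Lemma Cnorm_C0 : Cnorm C0 = 0.
Proof. by rewrite /Cnorm -sqrt_0; congr sqrt; rewrite /=; ring. Qed.

Lemma Cnorm_ge0 a : 0 <= Cnorm a.
Proof. exact: sqrt_pos. Qed.

Lemma Cnorm_mul a b : Cnorm (Cmul a b) = Cnorm a * Cnorm b.
Proof.
rewrite /Cnorm -sqrt_mult_alt; first by congr sqrt; rewrite /=; ring.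
by have := pow2_ge_0 (fst a); have := pow2_ge_0 (snd a); lra.
Qed.

Lemma Cnorm_RtoC a : 0 <= a -> Cnorm (RtoC a) = a.
Proof.
move=> a0; rewrite /Cnorm -[RHS](sqrt_pow2 _ a0); congr sqrt; rewrite /=; ring.
Qed.

Lemma Cnorm_prod X (s : seq X) F : (forall x, Cnorm (F x) <= 1) ->
  Cnorm (\big[Cmul/C1]_(x <- s) F x) <= 1.
Proof.
move=> h; apply: (big_ind (fun a => Cnorm a <= 1)) => //.
  by rewrite Cnorm_RtoC; lra.
move=> a b ha hb; rewrite Cnorm_mul.
by have := Cnorm_ge0 a; have := Cnorm_ge0 b; nra.
Qed.

Lemma fst_le_Cnorm a : Rabs (fst a) <= Cnorm a.
Proof.
rewrite -sqrt_Rsqr_abs; apply: sqrt_le_1_alt; rewrite /Rsqr.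
by have := pow2_ge_0 (snd a); rewrite /=; lra.
Qed.

Lemma snd_le_Cnorm a : Rabs (snd a) <= Cnorm a.
Proof.
rewrite -sqrt_Rsqr_abs; apply: sqrt_le_1_alt; rewrite /Rsqr.
by have := pow2_ge_0 (fst a); rewrite /=; lra.
Qed.

Lemma Cnorm_le a : Cnorm a <= Rabs (fst a) + Rabs (snd a).
Proof.
have f0 := Rabs_pos (fst a); have s0 := Rabs_pos (snd a).
rewrite -[X in _ <= X]sqrt_pow2; last lra.
by apply: sqrt_le_1_alt; rewrite -(pow2_abs (fst a)) -(pow2_abs (snd a)); nra.
Qed.

Lemma serC_fst (A : countType) (f : A -> Cx) :
  (fun n => fst (serC f n)) = ser (fun a => fst (f a)).
Proof. by apply: functional_extensionality => n; rewrite /serC /ser; case: pickle_inv. Qed.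

Lemma serC_snd (A : countType) (f : A -> Cx) :
  (fun n => snd (serC f n)) = ser (fun a => snd (f a)).
Proof. by apply: functional_extensionality => n; rewrite /serC /ser; case: pickle_inv. Qed.

Lemma Csummable_bound (A : countType) (f : A -> Cx) M :
  (forall F : seq A, uniq F -> \sum_(x <- F) Cnorm (f x) <= M) -> Csummable f.
Proof.
move=> h; exists M => N.
have -> : (fun n => Cnorm (serC f n)) = ser (fun a => Cnorm (f a)).
  apply: functional_extensionality => n; rewrite /serC /ser.
  by case: pickle_inv => // ; apply: Cnorm_C0.
by rewrite sum_fstser; apply/h/fstser_uniq.
Qed.

Definition CUsum (A : countType) (f : A -> Cx) (l : Cx) : Prop :=
  Usum (fun a => fst (f a)) (fst l) /\ Usum (fun a => snd (f a)) (snd l).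

Lemma CUsum_Csum (A : countType) (f : A -> Cx) l : CUsum f l -> Csum f = l.
Proof. by case: l => a b [/Usum_Rser_val /= h1 /Usum_Rser_val /= h2]; rewrite /Csum h1 h2. Qed.

Lemma CUsum_has_sum (A : countType) (f : A -> Cx) l : Csummable f -> CUsum f l -> Chas_sum f l.
Proof.
by move=> h [/Usum_infinite_sum h1 /Usum_infinite_sum h2]; rewrite /Chas_sum serC_fst serC_snd.
Qed.

Lemma CUsum_ext (A : countType) (f g : A -> Cx) l : (forall a, f a = g a) -> CUsum f l -> CUsum g l.
Proof. by move=> /functional_extensionality ->. Qed.

Lemma CUsum_bigsum (A : countType) (X : eqType) (s : seq X) (f : X -> A -> Cx) (l : X -> Cx) :
  (forall i, i \in s -> CUsum (f i) (l i)) ->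
  CUsum (fun a => \big[Cadd/C0]_(i <- s) f i a) (\big[Cadd/C0]_(i <- s) l i).
Proof.
move=> h; split.
  rewrite fst_csum (_ : (fun a => _) = fun a => \sum_(i <- s) fst (f i a)).
    by apply: Usum_bigsum => i si; apply: (proj1 (h i si)).
  by apply: functional_extensionality => a; apply: fst_csum.
rewrite snd_csum (_ : (fun a => _) = fun a => \sum_(i <- s) snd (f i a)).
  by apply: Usum_bigsum => i si; apply: (proj2 (h i si)).
by apply: functional_extensionality => a; apply: snd_csum.
Qed.

Lemma CUsum_scal (A : countType) (f : A -> Cx) c l :
  CUsum f l -> CUsum (fun a => Cmul (RtoC c) (f a)) (Cmul (RtoC c) l).
Proof.
case=> h1 h2; split.
  rewrite fst_RtoC_mul (_ : (fun a => _) = fun a => c * fst (f a)); first exact: Usum_scal.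
  by apply: functional_extensionality => a; apply: fst_RtoC_mul.
rewrite snd_RtoC_mul (_ : (fun a => _) = fun a => c * snd (f a)); first exact: Usum_scal.
by apply: functional_extensionality => a; apply: snd_RtoC_mul.
Qed.

Lemma CUsum_dominated (A : countType) (f : A -> Cx) (g : A -> R) M :
  (forall x, Cnorm (f x) <= g x) ->
  (forall F : seq A, uniq F -> \sum_(x <- F) g x <= M) -> exists l, CUsum f l.
Proof.
move=> fg hM.
have [a ha] := Usum_dominated (fun x => Rle_trans _ _ _ (fst_le_Cnorm (f x)) (fg x)) hM.
have [b hb] := Usum_dominated (fun x => Rle_trans _ _ _ (snd_le_Cnorm (f x)) (fg x)) hM.
by exists (a, b).
Qed.

Lemma CUsum_fibres (A B : countType) (f : A -> Cx) (g : A -> option B) (fib : B -> seq A) l :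
  CUsum f l -> (forall a, g a = None -> f a = C0) -> (forall b, uniq (fib b)) ->
  (forall a b, (a \in fib b) = (g a == Some b)) ->
  CUsum (fun b => \big[Cadd/C0]_(a <- fib b) f a) l.
Proof.
case=> h1 h2 hn u m; split.
  have -> : (fun b => fst (\big[Cadd/C0]_(a <- fib b) f a)) = fun b => \sum_(a <- fib b) fst (f a).
    by apply: functional_extensionality => b; apply: fst_csum.
  by apply: Usum_fibres h1 _ u m => a /hn ->.
have -> : (fun b => snd (\big[Cadd/C0]_(a <- fib b) f a)) = fun b => \sum_(a <- fib b) snd (f a).
  by apply: functional_extensionality => b; apply: snd_csum.
by apply: Usum_fibres h2 _ u m => a /hn ->.
Qed.

(** * Departures on skeletons *)

(* A skeleton lists the customers in order of arrival, a token holder carrying a label in X and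
   its token, a waiting customer being anonymous. *)
Section Skeleton.
Variables (Tt : finType) (X : Type).
Variables (om : X -> seq Tt -> Tt -> R) (sfun : seq Tt -> R).

Definition tok (o : option (X * Tt)) : seq Tt := if o is Some (_, t) then [:: t] else [::].

Fixpoint toks (k : seq (option (X * Tt))) : seq Tt :=
  if k is o :: k' then tok o ++ toks k' else [::].

(* [pr] lists the tokens held before the skeleton; tokens are distinct and a customer waits only
   behind some token holder. *)
Fixpoint valid (pr : seq Tt) (k : seq (option (X * Tt))) : bool :=
  match k with
  | [::] => true
  | None :: k' => (pr != [::]) && valid pr k'
  | Some (_, t) :: k' => (t \notin pr) && valid (rcons pr t) k'
  end.

(* Undoing the reallocation of the freed token t: if t occurs in k then its holder was waiting. *)
Fixpoint settle (pr : seq Tt) (t : Tt) (k : seq (option (X * Tt)))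
    (K : seq (option (X * Tt)) -> R) : R :=
  match k with
  | [::] => K [::]
  | None :: k' => settle pr t k' (fun x => K (None :: x))
  | Some (c, t') :: k' =>
      if t' == t then om c pr t * K (None :: k')
      else settle (rcons pr t') t k' (fun x => K (Some (c, t') :: x))
  end.

(** The departing customer stood right behind [pr], which fixes its rate; its token is handed only
    to customers of [k], all of them behind it. *)
Definition dep0 (pr : seq Tt) (t : Tt) (c0 : X) (k : seq (option (X * Tt)))
    (h : seq (option (X * Tt)) -> R) : R :=
  if t \in pr then 0 else sfun (rcons pr t) * settle pr t k (fun x => h (Some (c0, t) :: x)).
Arguments dep0 : simpl never.

(* Flow into k of departures of a customer with label c0 and token t, summed over its position. *)
Fixpoint dep (pr : seq Tt) (t : Tt) (c0 : X) (k : seq (option (X * Tt)))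
    (h : seq (option (X * Tt)) -> R) : R :=
  dep0 pr t c0 k h +
  match k with
  | [::] => 0
  | o :: k' => dep (pr ++ tok o) t c0 k' (fun x => h (o :: x))
  end.

Lemma toks_cat k1 k2 : toks (k1 ++ k2) = toks k1 ++ toks k2.
Proof. by elim: k1 => //= o k1 ->; rewrite catA. Qed.

Lemma valid_eqmem k : forall pr pr', pr =i pr' -> valid pr k = valid pr' k.
Proof.
elim: k => //= [[[c t]|]] k IH pr pr' e; last first.
  rewrite (IH _ _ e); congr (_ && _).
  case: pr pr' e => [|a pr] [|b pr'] // e; first by have := e b; rewrite mem_head.
  by have := e a; rewrite mem_head.
by rewrite e (IH _ (rcons pr' t)) // => x; rewrite !mem_rcons !inE e.
Qed.

Lemma valid_rconsC pr a b k : valid (rcons (rcons pr a) b) k = valid (rcons (rcons pr b) a) k.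
Proof. by apply: valid_eqmem => x; rewrite !mem_rcons !inE !mem_rcons !inE orbCA. Qed.

Lemma valid_uniq k : forall pr, uniq pr -> valid pr k -> uniq (pr ++ toks k).
Proof.
elim: k => [|[[c t]|] k IH] pr u /=; first by rewrite cats0.
- case/andP=> tn v; rewrite -cat_rcons; apply: IH => //.
  by rewrite rcons_uniq tn.
- by case/andP=> _; apply: IH.
Qed.

Lemma valid_rcons pr k o : valid pr (rcons k o) =
  valid pr k && (if o is Some (_, t) then t \notin pr ++ toks k else pr ++ toks k != [::]).
Proof.
elim: k pr => [|[[c t]|] k IH] pr /=.
- by case: o => [[c t]|]; rewrite cats0 andbT.
- by rewrite IH -cat_rcons andbA.
- by rewrite IH andbA.
Qed.

Lemma settle_ext pr t k K K' : (forall x, K x = K' x) -> settle pr t k K = settle pr t k K'.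
Proof. by move=> /functional_extensionality ->. Qed.

Lemma settle_sum (J : Type) (r : seq J) t k : forall pr F,
  settle pr t k (fun x => \sum_(i <- r) F i x) = \sum_(i <- r) settle pr t k (F i).
Proof.
elim: k => [|[[c t']|] k IH] pr F //=.
by case: eqP => _; [rewrite big_distrr | apply: IH].
Qed.

Lemma settle_scal a t k : forall pr F,
  settle pr t k (fun x => a * F x) = a * settle pr t k F.
Proof.
elim: k => [|[[c t']|] k IH] pr F //=.
by case: eqP => _; [ring | apply: IH].
Qed.

Lemma dep_sum (J : Type) (r : seq J) t c0 k : forall pr F,
  dep pr t c0 k (fun x => \sum_(i <- r) F i x) = \sum_(i <- r) dep pr t c0 k (F i).
Proof.
have h0 k' pr F : dep0 pr t c0 k' (fun x => \sum_(i <- r) F i x) =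
    \sum_(i <- r) dep0 pr t c0 k' (F i).
  by rewrite /dep0; case: ifP => _; [rewrite big1 | rewrite settle_sum big_distrr].
elim: k => [|o k IH] pr F /=; rewrite big_split /= h0 ?IH //.
by rewrite [X in _ = _ + X]big1.
Qed.

Lemma dep_scal a t c0 k : forall pr F,
  dep pr t c0 k (fun x => a * F x) = a * dep pr t c0 k F.
Proof.
have h0 k' pr F : dep0 pr t c0 k' (fun x => a * F x) = a * dep0 pr t c0 k' F.
  by rewrite /dep0; case: ifP => _; rewrite ?settle_scal; ring.
elim: k => [|o k IH] pr F /=; rewrite h0 ?IH; ring.
Qed.

Lemma dep_mem t c0 k : forall pr F, t \in pr -> dep pr t c0 k F = 0.
Proof.
elim: k => [|o k IH] pr F tp /=; rewrite /dep0 tp ?IH ?mem_cat ?tp //; ring.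
Qed.

Hypothesis om_ge0 : forall c pr t, 0 <= om c pr t.
Hypothesis sfun_ge0 : forall Ts, uniq Ts -> 0 <= sfun Ts.

(** The two functions are compared behind [rcons pr t] because, before the departure, [t] was held
    ahead of the customers of [k]. *)
Lemma settle_le t k : forall pr K K', t \notin pr -> valid pr k ->
  (forall x, valid (rcons pr t) x -> K x <= K' x) -> settle pr t k K <= settle pr t k K'.
Proof.
have ne pr : rcons pr t != [::] by case: pr.
elim: k => [|[[c t']|] k IH] pr K K' tn /= v h; first exact: h.
- case/andP: v => t'n v; case: eqP => [e|/eqP e].
    by apply: Rmult_le_compat_l => //; apply: h; rewrite /= ne -e.
  apply: IH => // [|x]; first by rewrite mem_rcons inE eq_sym negb_or e.
  by move=> vx; apply: h; rewrite /= mem_rcons inE negb_or e t'n /= valid_rconsC.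
- by case/andP: v => _ v; apply: IH => // x vx; apply: h; rewrite /= ne.
Qed.

Lemma dep_le t c0 k : forall pr h h', uniq pr -> valid pr k ->
  (forall x, valid pr x -> h x <= h' x) -> dep pr t c0 k h <= dep pr t c0 k h'.
Proof.
have hd pr k' h h' : uniq pr -> valid pr k' -> (forall x, valid pr x -> h x <= h' x) ->
    dep0 pr t c0 k' h <= dep0 pr t c0 k' h'.
  move=> u v hh; rewrite /dep0; case: ifPn => [_|tn]; first lra.
  apply: Rmult_le_compat_l; first by apply: sfun_ge0; rewrite rcons_uniq tn.
  by apply: settle_le => // x vx; apply: hh; rewrite /= tn.
elim: k => [|o k IH] pr h h' u v hh; apply: Rplus_le_compat; try exact: hd; first lra.
move: v; case: o => [[c t']|] /= /andP[n v].
  rewrite cats1; apply: IH => // [|x vx]; first by rewrite rcons_uniq n.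
  by apply: hh; rewrite /= n.
by rewrite cats0; apply: IH => // x vx; apply: hh; rewrite /= n.
Qed.

End Skeleton.

Lemma settle_eq (Tt : finType) X (om : X -> seq Tt -> Tt -> R) t k : forall pr K K',
  t \notin pr -> valid pr k ->
  (forall x, valid (rcons pr t) x -> K x = K' x) -> settle om pr t k K = settle om pr t k K'.
Proof.
have ne pr : rcons pr t != [::] by case: pr.
elim: k => [|[[c t']|] k IH] pr K K' tn /= v h; first exact: h.
- case/andP: v => t'n v; case: eqP => [e|/eqP e].
    by congr (_ * _); apply: h; rewrite /= ne -e.
  apply: IH => // [|x]; first by rewrite mem_rcons inE eq_sym negb_or e.
  by move=> vx; apply: h; rewrite /= mem_rcons inE negb_or e t'n /= valid_rconsC.
- by case/andP: v => _ v; apply: IH => // x vx; apply: h; rewrite /= ne.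
Qed.

(** * Summing out the types of the token holders *)

Section Fills.
Variables (Ct Tt : finType).
Variables (om : Ct -> seq Tt -> Tt -> R) (sfun : seq Tt -> R).

(** With labels in [unit], the skeleton definitions describe token sequences whose holder types have
    been summed out. *)
Definition om_sum (_ : unit) (pr : seq Tt) (t : Tt) : R := \sum_(c <- enum Ct) om c pr t.

Definition fill1 (o : option (unit * Tt)) : seq (option (Ct * Tt)) :=
  if o is Some (_, t) then [seq Some (c, t) | c <- enum Ct] else [:: None].

Fixpoint fills (s : seq (option (unit * Tt))) : seq (seq (option (Ct * Tt))) :=
  if s is o :: s' then [seq a :: k | a <- fill1 o, k <- fills s'] else [:: [::]].

Lemma fills_cons o s : fills (o :: s) = [seq a :: k | a <- fill1 o, k <- fills s].
Proof. by []. Qed.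

Lemma sum_fills_cons o s F :
  \sum_(k <- fills (o :: s)) F k = \sum_(a <- fill1 o) \sum_(k <- fills s) F (a :: k).
Proof. by rewrite /= big_allpairs_dep. Qed.

Lemma sum_fills_rcons o s F :
  \sum_(k <- fills (rcons s o)) F k = \sum_(k <- fills s) \sum_(a <- fill1 o) F (rcons k a).
Proof.
elim: s F => [|o' s IH] F.
  by rewrite sum_fills_cons /= big_seq1; apply: eq_bigr => a _; rewrite big_seq1.
by rewrite rcons_cons !sum_fills_cons; apply: eq_bigr => a _; rewrite IH.
Qed.

Lemma toks_fills s k : k \in fills s -> toks k = toks s.
Proof.
elim: s k => [|o s IH] k /=; first by rewrite inE => /eqP ->.
case/allpairsP => -[a k'] [/= ao /IH <- ->] /=; congr (_ ++ _).
by case: o ao => [[u t]|] /=; [case/mapP=> c _ -> | rewrite inE => /eqP ->].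
Qed.

Lemma size_fills s k : k \in fills s -> size k = size s.
Proof.
elim: s k => [|o s IH] k /=; first by rewrite inE => /eqP ->.
by case/allpairsP => -[a k'] [/= _ /IH <- ->].
Qed.

Lemma valid_fills s : forall k pr, k \in fills s -> valid pr k = valid pr s.
Proof.
elim: s => [|o s IH] k pr /=; first by rewrite inE => /eqP ->.
case/allpairsP => -[a k'] [/= ao /IH e ->].
by case: o ao => [[u t]|] /=; [case/mapP=> c _ -> | rewrite inE => /eqP ->]; rewrite e.
Qed.

Arguments fills : simpl never.

(** The holder of [t] becomes anonymous, so its label enters only through the factor [om] and sums
    to [om_sum]; all other labels are passed on unchanged. *)
Lemma settle_fills t s : forall pr K,
  \sum_(k <- fills s) settle om pr t k K =
  settle om_sum pr t s (fun s' => \sum_(k <- fills s') K k).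
Proof.
elim: s => [|[[[] t']|] s IH] pr K.
- by rewrite /= !big_seq1.
- rewrite sum_fills_cons big_map /=; case: eqP => e.
    by rewrite sum_fills_cons big_seq1 -big_distrlr.
  transitivity (\sum_(c <- enum Ct)
    settle om_sum (rcons pr t') t s (fun s' => \sum_(k <- fills s') K (Some (c, t') :: k))).
    by apply: eq_bigr => c _; rewrite -IH.
  rewrite -settle_sum; apply: settle_ext => x.
  by rewrite [RHS]sum_fills_cons /fill1 [RHS]big_map.
rewrite sum_fills_cons big_seq1 /= IH; apply: settle_ext => x.
by rewrite sum_fills_cons big_seq1.
Qed.

(** Lumpability of departures: the label [c0] becomes the label of the reinserted entry, so after
    summation the right-hand side again runs over all labellings. *)
Lemma dep_fills t s : forall pr h,
  \sum_(k <- fills s) \sum_(c0 <- enum Ct) dep om sfun pr t c0 k h =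
  dep om_sum sfun pr t tt s (fun s' => \sum_(k <- fills s') h k).
Proof.
have hd s0 pr h : \sum_(k <- fills s0) \sum_(c0 <- enum Ct) dep0 om sfun pr t c0 k h =
   dep0 om_sum sfun pr t tt s0 (fun s' => \sum_(k <- fills s') h k).
  rewrite /dep0; case: ifP => _; first by rewrite big1 // => k _; rewrite big1.
  rewrite exchange_big /=; under eq_bigr do rewrite -big_distrr /= settle_fills.
  rewrite -big_distrr -settle_sum /=; congr (_ * _); apply: settle_ext => x.
  by rewrite [RHS]sum_fills_cons /fill1 [RHS]big_map.
elim: s => [|o s IH] pr h.
  rewrite [RHS]/= -(hd [::]) Rplus_0_r /= !big_seq1.
  by apply: eq_bigr => c _; rewrite /= Rplus_0_r.
rewrite [RHS]/= -(hd (o :: s)).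
have E a k c : dep om sfun pr t c (a :: k) h = dep0 om sfun pr t c (a :: k) h +
   dep om sfun (pr ++ tok a) t c k (fun x => h (a :: x)) by [].
rewrite !sum_fills_cons.
under eq_bigr do under eq_bigr do under eq_bigr do rewrite E.
under eq_bigr do under eq_bigr do rewrite big_split /=.
under eq_bigr do rewrite big_split /=.
rewrite big_split /=; congr (_ + _).
have -> : (fun x => \sum_(k <- [seq a :: k | a <- fill1 o, k <- fills x]) h k) =
   (fun x => \sum_(a <- fill1 o) \sum_(k <- fills x) h (a :: k)).
  by apply: functional_extensionality => x; rewrite big_allpairs_dep.
rewrite dep_sum; apply: eq_big_seq => a ao; rewrite IH; congr (dep _ _ (_ ++ _) _ _ _ _).
by case: o ao => [[u t']|] /=; [case/mapP=> c _ -> | rewrite inE => /eqP ->].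
Qed.

End Fills.
Arguments fills : simpl never.

(** * Detailed states: words, weights and the intertwining identity *)

Fixpoint words {E : Type} (al : seq E) (n : nat) : seq (seq E) :=
  if n is n'.+1 then [seq e :: s | e <- al, s <- words al n'] else [:: [::]].

Lemma sum_words_S (E : Type) (al : seq E) n F :
  \sum_(s <- words al n.+1) F s = \sum_(e <- al) \sum_(s <- words al n) F (e :: s).
Proof. exact: big_allpairs_dep. Qed.

Lemma mem_words (E : eqType) (al : seq E) n s : (forall e, e \in al) ->
  (s \in words al n) = (size s == n).
Proof.
move=> h; elim: n s => [|n IH] [|e s] //=; first by apply/negbTE/negP => /allpairsP[[a b] []].
apply/allpairsP/idP => [[[a b] /= [_ bn [_ ->]]]|hs]; first by rewrite eqSS -IH.
by exists (e, s); rewrite /= h IH.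
Qed.

Lemma words_uniq (E : eqType) (al : seq E) n : uniq al -> uniq (words al n).
Proof.
move=> u; elim: n => //= n IH; apply: allpairs_uniq => //.
by move=> [a b] [c d] _ _ /= [-> ->].
Qed.

Arguments words : simpl never.

Section Detailed.
Variables (Ct Tt : finType).
Variables (lam : Ct -> R) (Tc : Ct -> {set Tt}) (assign : Ct -> {set Tt} -> Tt -> R).
Variables (sfun : seq Tt -> R) (eta : nat -> R).

Implicit Types (pr : seq Tt) (s x y u : seq (Ct * option Tt)).

Definition alphabet : seq (Ct * option Tt) :=
  [seq (c, None) | c <- enum Ct] ++ [seq (c, Some t) | t <- enum Tt, c <- enum Ct].

Lemma mem_alphabet e : e \in alphabet.
Proof.
case: e => c [t|]; rewrite mem_cat; apply/orP; [right | left].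
  by apply/allpairsP; exists (t, c); rewrite /= !mem_enum.
by apply/mapP; exists c; rewrite ?mem_enum.
Qed.

Lemma alphabet_uniq : uniq alphabet.
Proof.
rewrite cat_uniq map_inj_uniq ?enum_uniq; last by move=> a b [].
rewrite /= allpairs_uniq ?enum_uniq // ?andbT; last by move=> [a b] [c d] _ _ /= [-> ->].
by apply/hasPn => e /allpairsP[[t c] [_ _ ->]]; apply/mapP => -[].
Qed.

Lemma sum_alphabet F : \sum_(e <- alphabet) F e =
  \sum_(c <- enum Ct) F (c, None) + \sum_(t <- enum Tt) \sum_(c <- enum Ct) F (c, Some t).
Proof. by rewrite big_cat big_map big_allpairs_dep. Qed.

Notation level := (words alphabet).

Lemma mem_level n s : (s \in level n) = (size s == n).
Proof. exact/mem_words/mem_alphabet. Qed.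

Lemma level_uniq n : uniq (level n).
Proof. exact/words_uniq/alphabet_uniq. Qed.

Definition skE (e : Ct * option Tt) : option (Ct * Tt) :=
  if e.2 is Some t then Some (e.1, t) else None.
Definition sk s : seq (option (Ct * Tt)) := map skE s.

Lemma toks_sk s : toks (sk s) = actv s.
Proof. by elim: s => //= -[c [t|]] s IH /=; rewrite IH. Qed.

Lemma actv_rcons pre e : actv (rcons pre e) = actv pre ++ tok (skE e).
Proof. by rewrite -!toks_sk /sk map_rcons -cats1 toks_cat /= cats0. Qed.

Lemma held_actv s : held s = [set t in actv s].
Proof.
apply/setP => t; rewrite !inE.
by elim: s => //= -[c [t'|]] s IH /=; rewrite !inE IH.
Qed.

(** Unnormalised kernel from skeletons to detailed states. A holder gets weight 1 because its type
    belongs to the skeleton; the value 0 for a repeated token confines the kernel to states with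
    distinct tokens. *)
Definition weight1 pr (e : Ct * option Tt) : R :=
  match e.2 with
  | None => if Tc e.1 \subset [set t in pr] then lam e.1 else 0
  | Some t => if t \in pr then 0 else 1
  end.

Fixpoint weight pr s : R :=
  if s is e :: s' then weight1 pr e * weight (pr ++ tok (skE e)) s' else 1.

Lemma weight1_eqmem pr pr' e : pr =i pr' -> weight1 pr e = weight1 pr' e.
Proof.
move=> h; rewrite /weight1; case: e.2 => [t|]; first by rewrite h.
by have -> : [set t in pr] = [set t in pr'] by apply/setP => t; rewrite !inE h.
Qed.

Lemma weight_eqmem s : forall pr pr', pr =i pr' -> weight pr s = weight pr' s.
Proof.
elim: s => //= e s IH pr pr' h; rewrite (weight1_eqmem _ h).
by congr (_ * _); apply: IH => t; rewrite !mem_cat h.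
Qed.

Lemma weight_rcons pr s e : weight pr (rcons s e) = weight pr s * weight1 (pr ++ actv s) e.
Proof.
rewrite -toks_sk; elim: s pr => [|a s IH] pr /=; first by rewrite cats0; ring.
by rewrite IH catA; ring.
Qed.

(** Weight of a type-[c] customer waiting behind [rcons pr t] and ready to claim [t] once it is
    freed. *)
Definition om (c : Ct) pr (t : Tt) : R :=
  if (t \in Tc c) && (Tc c \subset [set x in rcons pr t]) then lam c else 0.

(* The preimages u of y under the reallocation of t, summed against F. *)
Fixpoint ungive (t : Tt) y (F : seq (Ct * option Tt) -> R) : R :=
  if y is e :: y' then
    (if (e.2 == Some t) && (t \in Tc e.1) then F ((e.1, None) :: y') else 0) +
    (if (e.2 == None) && (t \in Tc e.1) then 0 else ungive t y' (fun u => F (e :: u)))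
  else F [::].

(** Each entry of [y] has either just received [t] or was there before; the latter ends the search
    at a waiting customer compatible with [t], who would have claimed it. *)
Lemma ungiveE t y F :
  \sum_(u <- level (size y)) (if give Tc t u == y then F u else 0) = ungive t y F.
Proof.
elim: y F => [|e y IH] F; first by rewrite big_seq1.
rewrite sum_words_S /=.
suff E a : \sum_(u <- level (size y)) (if give Tc t (a :: u) == e :: y then F (a :: u) else 0) =
    (if a == (e.1, None) then
      (if (e.2 == Some t) && (t \in Tc e.1) then F ((e.1, None) :: y) else 0) else 0) +
    (if a == e then (if (e.2 == None) && (t \in Tc e.1) then 0
                     else ungive t y (fun u => F (e :: u))) else 0).
  under eq_bigr do rewrite E.
  by rewrite big_split /= !sumR_uniq_pick ?alphabet_uniq ?mem_alphabet.
case: e a => c o [c' o'] /=; rewrite -IH.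
case ncl: ((o' == None) && (t \in Tc c')).
  case/andP: ncl => /eqP -> tc'.
  have -> : (\sum_(u <- level (size y)) (if (c', Some t) :: u == (c, o) :: y then
      F ((c', None) :: u) else 0)) =
    \sum_(u <- level (size y)) (if u == y then
      (if (c', Some t) == (c, o) then F ((c', None) :: u) else 0) else 0).
    by apply: eq_bigr => u _; rewrite eqseq_cons; case: (_ == (c, o)); case: (u == y).
  rewrite sumR_uniq_pick ?level_uniq ?mem_level // !xpair_eqE /=.
  case: (eqVneq c' c) => [ec|_] /=; last lra.
  subst c'; rewrite tc' andbT [o == Some t]eq_sym.
  by case: o => [t0|] /=; lra.
have -> : (\sum_(u <- level (size y)) (if (c', o') :: give Tc t u == (c, o) :: y then
    F ((c', o') :: u) else 0)) =
  if (c', o') == (c, o) then \sum_(u <- level (size y))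
    (if give Tc t u == y then F ((c', o') :: u) else 0) else 0.
  case: ifP => e; last by rewrite big1 // => u _; rewrite eqseq_cons e.
  by apply: eq_bigr => u _; rewrite eqseq_cons e.
case: (eqVneq (c', o') (c, o)) => [[ec eo]|ne].
  subst c' o'; rewrite ncl xpair_eqE eqxx /= [o == None]eq_sym.
  by case: o {ncl} => [o|] /=; lra.
case: (eqVneq (c', o') (c, None)) => [[ec eo]|_] /=; last lra.
by subst c' o'; rewrite /= in ncl; rewrite ncl andbF; lra.
Qed.

Lemma ungive_add t y F G : ungive t y (fun u => F u + G u) = ungive t y F + ungive t y G.
Proof. by elim: y F G => [|e y IH] F G //=; rewrite IH; do 2?case: ifP => _; ring. Qed.

Lemma ungive_scal a t y F : ungive t y (fun u => a * F u) = a * ungive t y F.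
Proof. by elim: y F => [|e y IH] F //=; rewrite IH; do 2?case: ifP => _; ring. Qed.

Lemma ungive_ext t y F G : (forall u, F u = G u) -> ungive t y F = ungive t y G.
Proof. by move=> /functional_extensionality ->. Qed.

(** Adjoint of [deps]: the departed customer is put back at every possible place, with the departure
    rate belonging to that place. *)
Fixpoint inserts pr (t : Tt) (c0 : Ct) u (M : seq (Ct * option Tt) -> R) : R :=
  sfun (rcons pr t) * M ((c0, Some t) :: u) +
  if u is e :: u' then inserts (pr ++ tok (skE e)) t c0 u' (fun x => M (e :: x)) else 0.

Lemma inserts_scal a t c0 u : forall pr M,
  inserts pr t c0 u (fun x => a * M x) = a * inserts pr t c0 u M.
Proof. by elim: u => [|e u IH] pr M /=; rewrite ?IH; ring. Qed.

Lemma inserts_ext pr t c0 u F G : (forall x, F x = G x) ->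
  inserts pr t c0 u F = inserts pr t c0 u G.
Proof. by move=> /functional_extensionality ->. Qed.

Lemma inserts_mem t c0 u : forall pr h, t \in pr ->
  inserts pr t c0 u (fun x => weight pr x * h x) = 0.
Proof.
have w0 pr0 : t \in pr0 -> weight1 pr0 (c0, Some t) = 0 by rewrite /weight1 /= => ->.
elim: u => [|e u IH] pr h tp /=; rewrite w0 //; first by ring.
rewrite (inserts_ext _ _ _ _ (G := fun x => weight1 pr e *
  (weight (pr ++ tok (skE e)) x * h (e :: x)))); last by move=> x; ring.
by rewrite inserts_scal IH ?mem_cat ?tp //; ring.
Qed.

Lemma subset_rcons_notin c pr t : t \notin Tc c ->
  (Tc c \subset [set x in rcons pr t]) = (Tc c \subset [set x in pr]).
Proof.
move=> tn; apply/subsetP/subsetP => h x xT; have := h x xT.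
  by rewrite !inE mem_rcons inE => /orP[/eqP e|//]; rewrite -e xT in tn.
by rewrite !inE mem_rcons inE => ->; rewrite orbT.
Qed.

Lemma weight1_claim c pr t : t \in Tc c -> t \notin pr -> weight1 pr (c, None) = 0.
Proof.
move=> tc tn; rewrite /weight1 /=; case: ifP => // /subsetP /(_ t tc).
by rewrite inE (negbTE tn).
Qed.

(** Before the reallocation [t] is held ahead, afterwards by a customer further back. The waiting
    customers in between are incompatible with [t], so their weight is the same with and without it;
    behind the new holder the set of tokens ahead is unchanged. *)
Lemma settle_weight t y : forall pr K, t \notin pr ->
  ungive t y (fun u => weight (rcons pr t) u * K (sk u)) =
  weight pr y * settle om pr t (sk y) K.
Proof.
elim: y => [|[c [t'|]] y IH] pr K tp; first by rewrite /=; ring.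
- case: (eqVneq t' t) => [->|ne] /=; rewrite ?eqxx ?(inj_eq Some_inj) ?(negbTE ne) /=.
    (* Had this holder kept [t], the token would be held twice, so the weight is 0. Writing [0 * 0]
       lets [ungive_scal] extract the zero. *)
    rewrite (ungive_ext t y (G := fun u => 0 * 0)); last first.
      by move=> u; rewrite /= /weight1 /= mem_rcons mem_head /=; ring.
    rewrite ungive_scal {2}/weight1 /= (negbTE tp) cats0 cats1 /om /weight1 /skE /=.
    by case: (t \in Tc c) => /=; try case: ifP => _; ring.
  rewrite (ungive_ext t y (G := fun u => weight1 pr (c, Some t') *
     (weight (rcons (rcons pr t') t) u * K (Some (c, t') :: sk u)))); last first.
    move=> u; rewrite cats1 /weight1 /= mem_rcons inE (negbTE ne) /=.
    rewrite (weight_eqmem _ (pr' := rcons (rcons pr t') t)) ?Rmult_assoc //.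
    by move=> x; rewrite !mem_rcons !inE !mem_rcons !inE orbCA.
  rewrite ungive_scal (IH (rcons pr t') (fun k => K (Some (c, t') :: k))) ?cats1; first ring.
  by rewrite mem_rcons inE eq_sym negb_or ne.
rewrite /= !cats0; case: ifPn => [tc|tc].
  by rewrite (weight1_claim tc tp); ring.
rewrite (ungive_ext t y (G := fun u => weight1 pr (c, None) *
   (weight (rcons pr t) u * K (None :: sk u)))); last first.
  by move=> u; rewrite /weight1 /= subset_rcons_notin // Rmult_assoc.
by rewrite ungive_scal (IH pr (fun k => K (None :: k))) //; ring.
Qed.

Lemma dep_weight t c0 y : forall pr h,
  ungive t y (fun u => inserts pr t c0 u (fun x => weight pr x * h (sk x))) =
  weight pr y * dep om sfun pr t c0 (sk y) h.
Proof.
have hd pr y' h : ungive t y' (fun u => sfun (rcons pr t) *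
      (weight pr ((c0, Some t) :: u) * h (sk ((c0, Some t) :: u)))) =
    weight pr y' * dep0 om sfun pr t c0 (sk y') h.
  rewrite ungive_scal /dep0; case: (boolP (t \in pr)) => tp.
    rewrite (ungive_ext t y' (G := fun u => 0 * 0)) ?ungive_scal; first ring.
    by move=> u; rewrite /= {1}/weight1 /= tp; ring.
  rewrite (ungive_ext t y' (G := fun u => weight (rcons pr t) u *
    h (Some (c0, t) :: sk u))).
    rewrite (settle_weight y' (fun k => h (Some (c0, t) :: k)) tp).
    by rewrite -!Rmult_assoc (Rmult_comm (sfun _)).
  by move=> u; rewrite /= /weight1 /= (negbTE tp) cats1 Rmult_1_l.
elim: y => [|e y IH] pr h.
  by have := hd pr [::] h; rewrite /= => ->; ring.
(* The departed customer stood either in front, which [hd] handles, or behind the first entry; [tl]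
   collects the latter positions. *)
pose tl u := if u is e' :: u' then inserts (pr ++ tok (skE e')) t c0 u'
  (fun x => weight pr (e' :: x) * h (sk (e' :: x))) else 0.
rewrite (ungive_ext t (e :: y) (G := fun u => sfun (rcons pr t) *
      (weight pr ((c0, Some t) :: u) * h (sk ((c0, Some t) :: u))) + tl u)); last by case.
rewrite ungive_add hd [dep _ _ _ _ _ _ _]/= Rmult_plus_distr_l; congr (_ + _).
have tlE e' u : tl (e' :: u) = weight1 pr e' * inserts (pr ++ tok (skE e')) t c0 u
    (fun x => weight (pr ++ tok (skE e')) x * h (skE e' :: sk x)).
  by rewrite -inserts_scal; apply: inserts_ext => x; rewrite /= Rmult_assoc.
clearbody tl; rewrite [ungive _ _ _]/= tlE /= (ungive_ext _ _ (tlE e)) ungive_scal.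
rewrite (IH (pr ++ tok (skE e)) (fun k => h (skE e :: k))).
(* Here the departed holder of [t] would stand behind a waiting customer that takes [t]. That
   customer is blocked by the tokens ahead of it, so [t] is among them and would be held twice. *)
have -> : (if (e.2 == Some t) && (t \in Tc e.1) then weight1 pr (e.1, None) *
   inserts (pr ++ [::]) t c0 y (fun x => weight (pr ++ [::]) x * h (skE (e.1, None) :: sk x))
   else 0) = 0.
  case: ifP => // /andP[_ tc]; rewrite cats0; case: (boolP (t \in pr)) => tp.
    by rewrite (inserts_mem c0 y (fun x => h (skE (e.1, None) :: sk x)) tp); ring.
  by rewrite (weight1_claim tc tp); ring.
case: e {tlE tl} => c [t'|] /=; first by ring.
case: ifP => /= tc; last by ring.
case: (boolP (t \in pr)) => tp; last by rewrite (weight1_claim tc tp); ring.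
by rewrite dep_mem ?cats0 //; ring.
Qed.

(** Each departure is parametrised by the departed customer [(c0, t)] and the rest [u] of the state.
    [N] is kept apart from the length because the induction consumes the state while the argument of
    [eta] stays fixed. *)
Lemma sum_deps (y : seq (Ct * option Tt)) N n : forall pre M,
  \sum_(x <- level n.+1) M x * \sum_(q <- deps Tc sfun eta pre x N) (if q.1 == y then q.2 else 0)
  = eta N * \sum_(t <- enum Tt) \sum_(c0 <- enum Ct) \sum_(u <- level n)
      (if give Tc t (pre ++ u) == y then inserts (actv pre) t c0 u M else 0).
Proof.
have hd n0 pre M : \sum_(e <- alphabet) \sum_(s <- level n0) M (e :: s) *
     \sum_(q <- (if e.2 is Some t then
          [:: (give Tc t (pre ++ s), eta N * sfun (actv (rcons pre e)))] else [::]))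
       (if q.1 == y then q.2 else 0) =
   eta N * \sum_(t <- enum Tt) \sum_(c0 <- enum Ct) \sum_(u <- level n0)
      (if give Tc t (pre ++ u) == y then sfun (rcons (actv pre) t) * M ((c0, Some t) :: u) else 0).
  rewrite sum_alphabet big1 ?Rplus_0_l; last first.
    by move=> c _; rewrite big1 // => s _; rewrite big_nil; ring.
  rewrite big_distrr; apply: eq_bigr => t _; rewrite big_distrr; apply: eq_bigr => c _.
  rewrite big_distrr; apply: eq_bigr => u _ /=; rewrite big_seq1 /= actv_rcons /= cats1.
  by case: ifP => _; ring.
elim: n => [|n IH] pre M; rewrite sum_words_S.
  transitivity (eta N * \sum_(t <- enum Tt) \sum_(c <- enum Ct) \sum_(u <- level 0)
     (if give Tc t (pre ++ u) == y then sfun (rcons (actv pre) t) * M ((c, Some t) :: u) else 0)).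
    by rewrite -hd; apply: eq_bigr => e _; rewrite !big_seq1 /= !cats0.
  congr (_ * _); apply: eq_bigr => t _; apply: eq_bigr => c _.
  by rewrite !big_seq1 /= Rplus_0_r.
transitivity (\sum_(e <- alphabet) (\sum_(s <- level n.+1) M (e :: s) *
     \sum_(q <- (if e.2 is Some t then
          [:: (give Tc t (pre ++ s), eta N * sfun (actv (rcons pre e)))] else [::]))
       (if q.1 == y then q.2 else 0) +
   eta N * \sum_(t <- enum Tt) \sum_(c0 <- enum Ct) \sum_(u <- level n)
      (if give Tc t (rcons pre e ++ u) == y
       then inserts (actv (rcons pre e)) t c0 u (fun x => M (e :: x)) else 0))).
  apply: eq_bigr => e _; rewrite -IH -big_split /=; apply: eq_bigr => s _.
  by rewrite big_cat /=; ring.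
rewrite big_split /= hd -big_distrr -Rmult_plus_distr_l; congr (_ * _).
rewrite [X in _ + X]exchange_big -big_split; apply: eq_bigr => t _ /=.
rewrite [X in _ + X]exchange_big -big_split; apply: eq_bigr => c _ /=.
rewrite [RHS]sum_words_S [X in X + _]sum_words_S -big_split; apply: eq_bigr => e _ /=.
rewrite -big_split; apply: eq_bigr => u _ /=; rewrite cat_rcons actv_rcons.
by case: ifP => _; ring.
Qed.

(** Intertwining for departures: the skeleton flow [dep] is carried by the kernel to the detailed
    flow. *)
Lemma departures_into y h N :
  \sum_(x <- level (size y).+1) (weight [::] x * h (sk x)) *
     \sum_(q <- deps Tc sfun eta [::] x N) (if q.1 == y then q.2 else 0) =
  eta N * (weight [::] y *
     \sum_(t <- enum Tt) \sum_(c0 <- enum Ct) dep om sfun [::] t c0 (sk y) h).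
Proof.
rewrite sum_deps; congr (_ * _); rewrite big_distrr; apply: eq_bigr => t _.
rewrite big_distrr; apply: eq_bigr => c _.
by rewrite /= -dep_weight -ungiveE.
Qed.

End Detailed.

(** * Explicit invariant weights of the token process *)

Section Queue.
Variables (Ct Tt : finType).
Variables (lam : Ct -> R) (Tc : Ct -> {set Tt}) (assign : Ct -> {set Tt} -> Tt -> R).
Variables (sfun : seq Tt -> R) (eta : nat -> R).
Hypothesis lam_gt0 : forall c, 0 < lam c.
Hypothesis Tc_neq0 : forall c, Tc c != set0.
Hypothesis rule : assign_rule Tc assign.
Hypothesis assignC : assignment_condition lam assign.
Hypothesis orderI : order_independent sfun eta.

Definition total_rate : R := \sum_(c <- enum Ct) lam c.

Lemma assign_ge0 c U t : 0 <= assign c U t.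
Proof. exact: (proj1 (proj1 rule c U t)). Qed.

Lemma assign_out c U t : t \notin Tc c :\: U -> assign c U t = 0.
Proof.
move=> h; case: (Req_dec (assign c U t) 0) => // /(proj2 (proj1 rule c U t)) h'.
by rewrite h' in h.
Qed.

Lemma sum_assign c (U : {set Tt}) : ~~ (Tc c \subset U) -> \sum_(t <- enum Tt) assign c U t = 1.
Proof. by move=> h; rewrite -rsumE; apply: (proj2 rule). Qed.

Lemma sfun_ge0 Ts : uniq Ts -> 0 <= sfun Ts.
Proof. exact: (proj1 orderI). Qed.

Lemma kfun_perm s1 s2 : uniq s1 -> perm_eq s1 s2 -> kfun sfun s1 = kfun sfun s2.
Proof. exact: (proj1 (proj2 orderI)). Qed.

Lemma kfun_gt0 Ts : uniq Ts -> Ts != [::] -> 0 < kfun sfun Ts.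
Proof. by move=> u /eqP ne; apply: (proj1 (proj2 (proj2 orderI))). Qed.

Lemma eta_gt0 m : (0 < m)%N -> 0 < eta m.
Proof. exact: (proj2 (proj2 (proj2 orderI))). Qed.

Lemma kfun_nil : kfun sfun [::] = 0.
Proof. by []. Qed.

Lemma kfun_rcons Ts t : kfun sfun (rcons Ts t) = kfun sfun Ts + sfun (rcons Ts t).
Proof.
rewrite /kfun !rsumE size_rcons -[(size Ts).+1]addn1 iotaD big_cat big_seq1 /=.
congr (_ + _); last by rewrite add1n -(size_rcons Ts t) take_size.
apply: eq_big_seq => j; rewrite mem_iota add1n ltnS => /andP[_ h].
by rewrite -cats1 takel_cat.
Qed.

Lemma kfun_ge0 Ts : uniq Ts -> 0 <= kfun sfun Ts.
Proof.
move=> u; case: (eqVneq Ts [::]) => [->|ne]; first by rewrite kfun_nil; lra.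
by apply/Rlt_le/kfun_gt0.
Qed.

Lemma prodlam_rcons Ts t :
  prodlam lam assign (rcons Ts t) = prodlam lam assign Ts * lamt lam assign [set x in Ts] t.
Proof.
suff gen pr : prodlam_aux lam assign pr (rcons Ts t) =
    prodlam_aux lam assign pr Ts * lamt lam assign [set x in pr ++ Ts] t by exact: gen.
elim: Ts pr => [|a Ts IH] pr /=; first by rewrite cats0 Rmult_1_r Rmult_1_l.
by rewrite IH cat_rcons Rmult_assoc.
Qed.

Lemma lamtE U t : lamt lam assign U t = \sum_(c <- enum Ct) lam c * assign c U t.
Proof. by rewrite /lamt rsumE. Qed.

Lemma lamt_ge0 U t : 0 <= lamt lam assign U t.
Proof.
rewrite lamtE; apply: sumR_ge0 => c _.
by have := lam_gt0 c; have := assign_ge0 c U t; nra.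
Qed.

Lemma prodlam_ge0 Ts : 0 <= prodlam lam assign Ts.
Proof.
elim/last_ind: Ts => [|Ts t IH]; first by rewrite /prodlam /=; lra.
by rewrite prodlam_rcons; have := lamt_ge0 [set x in Ts] t; nra.
Qed.

Lemma lamUE U : lamU lam Tc U = \sum_(c <- enum Ct) if Tc c \subset U then lam c else 0.
Proof. by rewrite /lamU rsumE. Qed.

Lemma sum_lamt (pr : seq Tt) :
  \sum_(t <- enum Tt) (if t \in pr then 0 else lamt lam assign [set x in pr] t)
  = total_rate - lamU lam Tc [set x in pr].
Proof.
rewrite lamUE -sumR_sub.
rewrite (eq_bigr (fun t => \sum_(c <- enum Ct) lam c * assign c [set x in pr] t)); last first.
  move=> t _; rewrite lamtE; case: ifP => // tp; rewrite big1 // => c _.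
  by rewrite assign_out ?Rmult_0_r // !inE tp.
rewrite exchange_big; apply: eq_bigr => c _; rewrite -big_distrr /=.
case: (boolP (Tc c \subset _)) => h; last by rewrite sum_assign //; ring.
rewrite big1; first ring.
move=> t _; apply: assign_out; rewrite !inE; apply/negP => /andP[tn tc].
by have := subsetP h t tc; rewrite inE (negbTE tn).
Qed.

Notation omU := (om_sum (om lam Tc)).

Lemma om_ge0 c pr t : 0 <= om lam Tc c pr t.
Proof. by rewrite /om; case: ifP => _; [have := lam_gt0 c; lra | lra]. Qed.

Lemma om_sum_ge0 u pr t : 0 <= omU u pr t.
Proof. by apply: sumR_ge0 => c _; apply: om_ge0. Qed.

Lemma om_sumE u (pr : seq Tt) t : t \notin pr ->
  omU u pr t = lamU lam Tc [set x in rcons pr t] - lamU lam Tc [set x in pr].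
Proof.
move=> tn; rewrite !lamUE -sumR_sub; apply: eq_bigr => c _; rewrite /om.
case: (boolP (t \in Tc c)) => tc /=; last first.
  by rewrite subset_rcons_notin //; case: ifP => _; ring.
have -> : (Tc c \subset [set x in pr]) = false.
  by apply/negP => /subsetP /(_ t tc); rewrite inE (negbTE tn).
by ring.
Qed.

(* Total flow of departures freeing t into a token sequence of weight one. *)
Fixpoint freed_rate (pr : seq Tt) (t : Tt) (s : seq (option (unit * Tt))) : R :=
  match s with
  | [::] => lamt lam assign [set x in pr] t
  | None :: s' => freed_rate pr t s'
  | Some (u, t') :: s' => if t' == t then omU u pr t else freed_rate (rcons pr t') t s'
  end.

(** Each held token contributes the increment of [lamU] that it causes, which telescopes; the
    available tokens contribute the arrival rates of the types not blocked at the end. *)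
Lemma sum_freed_rate s : forall pr, valid pr s ->
  \sum_(t <- enum Tt) (if t \in pr then 0 else freed_rate pr t s)
  = total_rate - lamU lam Tc [set x in pr].
Proof.
elim: s => [|[[[] t']|] s IH] pr /=; first by move=> _; apply: sum_lamt.
- case/andP=> tn /IH e.
  rewrite (eq_bigr (fun t => (if t == t' then omU tt pr t else 0) +
     (if t \in rcons pr t' then 0 else freed_rate (rcons pr t') t s))); last first.
    move=> t _; rewrite mem_rcons inE [t' == t]eq_sym; case: eqP => [->|_] /=.
      by rewrite (negbTE tn) Rplus_0_r.
    by case: ifP => _; ring.
  have telescope (a b c : R) : a - b + (c - a) = c - b by ring.
  rewrite big_split /= e sumR_uniq_pick ?enum_uniq ?mem_enum // om_sumE //; exact: telescope.
- by case/andP=> _ /IH.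
Qed.

Fixpoint kweight (pr : seq Tt) (s : seq (option (unit * Tt))) : R :=
  match s with
  | [::] => 1
  | None :: s' => kweight pr s' / kfun sfun pr
  | Some (_, t) :: s' => kweight (rcons pr t) s' / kfun sfun (rcons pr t)
  end.

Lemma kweight_perm s : forall pr pr', uniq pr -> valid pr s -> perm_eq pr pr' ->
  kweight pr s = kweight pr' s.
Proof.
elim: s => [|[[u t]|] s IH] pr pr' up //= /andP[n v] pe.
  have ur : uniq (rcons pr t) by rewrite rcons_uniq n.
  have pr2 : perm_eq (rcons pr t) (rcons pr' t) by rewrite -!cats1 perm_cat2r.
  by rewrite (IH _ _ ur v pr2) (kfun_perm ur pr2).
by rewrite (IH _ _ up v pe) (kfun_perm up pe).
Qed.

Lemma kweight_rcons pr s o : kweight pr (rcons s o) =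
  kweight pr s / kfun sfun (pr ++ toks s ++ tok o).
Proof.
elim: s pr => [|[[u t]|] s IH] pr /=.
- by case: o => [[u t]|] /=; rewrite ?cats1 ?cats0.
- by rewrite IH cat_rcons /Rdiv; ring.
- by rewrite IH /Rdiv; ring.
Qed.

Lemma kweight_gt0 s : forall pr, uniq pr -> valid pr s -> 0 < kweight pr s.
Proof.
elim: s => [|[[u t]|] s IH] pr up /=; first by lra.
  case/andP=> n v; have ur : uniq (rcons pr t) by rewrite rcons_uniq n.
  by apply: Rdiv_lt_0_compat; [apply: IH | apply: kfun_gt0; last by case: (pr)].
by case/andP=> n v; apply: Rdiv_lt_0_compat; [apply: IH | apply: kfun_gt0].
Qed.

(** For [pr] empty this is the product form without its [eta] factors and without the powers of
    [lamU], which belong to the kernel. *)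
Definition gweight (pr : seq Tt) (s : seq (option (unit * Tt))) : R :=
  prodlam lam assign (pr ++ toks s) * kweight pr s.

Lemma gweight_None pr s : gweight pr (None :: s) = gweight pr s / kfun sfun pr.
Proof. by rewrite /gweight /=; rewrite /Rdiv; ring. Qed.

Lemma gweight_Some pr u t s :
  gweight pr (Some (u, t) :: s) = gweight (rcons pr t) s / kfun sfun (rcons pr t).
Proof. by rewrite /gweight /= cat_rcons /Rdiv; ring. Qed.

Lemma gweight_perm pr pr' s : uniq pr -> valid pr s -> perm_eq pr pr' ->
  gweight pr s = gweight pr' s.
Proof.
move=> u v pe; rewrite /gweight (kweight_perm u v pe); congr (_ * _).
by apply: assignC; [apply: valid_uniq | rewrite perm_cat2r].
Qed.

Lemma gweight_ge0 pr s : uniq pr -> valid pr s -> 0 <= gweight pr s.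
Proof.
move=> u v; apply: Rmult_le_pos; first exact: prodlam_ge0.
exact/Rlt_le/kweight_gt0.
Qed.

(* The term with kfun pr accounts for the customers ahead; it vanishes for pr = [::]. *)
Lemma dep_gweight t s : forall pr, t \notin pr -> uniq pr -> valid pr s ->
  kfun sfun pr * settle omU pr t s (fun x => gweight pr (Some (tt, t) :: x)) +
  dep omU sfun pr t tt s (gweight pr) = freed_rate pr t s * gweight pr s.
Proof.
have ne pr (a : Tt) : rcons pr a != [::] by case: pr.
(* The customers ahead and the one reinserted here have total rate [kfun (rcons pr t)], which
   cancels the denominator of the reinserted entry. *)
have headE pr s0 : t \notin pr -> uniq pr ->
    kfun sfun pr * settle omU pr t s0 (fun x => gweight pr (Some (tt, t) :: x)) +
    dep0 omU sfun pr t tt s0 (gweight pr) = settle omU pr t s0 (gweight (rcons pr t)).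
  move=> tn up; rewrite /dep0 (negbTE tn) -Rmult_plus_distr_r -kfun_rcons.
  rewrite (settle_ext _ _ _ _ (K' := fun x => / kfun sfun (rcons pr t) * gweight (rcons pr t) x)).
    rewrite settle_scal -Rmult_assoc Rinv_r ?Rmult_1_l //.
    by apply/Rgt_not_eq/kfun_gt0; rewrite ?rcons_uniq ?tn.
  by move=> x; rewrite gweight_Some /Rdiv Rmult_comm.
elim: s => [|o s IH] pr tn up v.
  rewrite [dep _ _ _ _ _ _ _]/= Rplus_0_r headE // /gweight /= !cats0 prodlam_rcons.
  by rewrite !Rmult_1_r Rmult_comm.
rewrite [dep _ _ _ _ _ _ _]/= -Rplus_assoc headE //.
have ut : uniq (rcons pr t) by rewrite rcons_uniq tn.
case: o v => [[[] t']|] /= /andP[n v].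
- case: eqP => [e|/eqP e].
    rewrite dep_mem ?mem_cat ?e ?inE ?eqxx ?orbT // gweight_None gweight_Some.
    by rewrite /= -/(om_sum _ tt _ _); ring.
  have up' : uniq (rcons pr t') by rewrite rcons_uniq n.
  have tn' : t \notin rcons pr t' by rewrite mem_rcons inE eq_sym negb_or e.
  have ut' : uniq (rcons (rcons pr t') t) by rewrite rcons_uniq tn'.
  have k' : kfun sfun (rcons pr t') <> 0 by apply/Rgt_not_eq/kfun_gt0.
  rewrite gweight_Some.
  have -> : freed_rate (rcons pr t') t s * (gweight (rcons pr t') s / kfun sfun (rcons pr t')) =
    / kfun sfun (rcons pr t') * (freed_rate (rcons pr t') t s * gweight (rcons pr t') s).
    by rewrite /Rdiv; ring.
  rewrite -IH // Rmult_plus_distr_l -Rmult_assoc Rinv_l // Rmult_1_l; congr (_ + _).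
    (* The induction hypothesis puts [t] after [t'], whereas [t] has to come first: both permutation
       invariances, of claims and of service, enter here. *)
    apply: settle_eq => // x vx; rewrite !gweight_Some.
    have pe : perm_eq (rcons (rcons pr t') t) (rcons (rcons pr t) t').
      by rewrite -!cats1 -!catA perm_cat2l /= (perm_catC [:: t'] [:: t]).
    by rewrite (gweight_perm ut' vx pe) (kfun_perm ut' pe).
  rewrite -dep_scal cats1; congr (dep _ _ _ _ _ _ _).
  by apply: functional_extensionality => x; rewrite gweight_Some /Rdiv Rmult_comm.
- have k0 : kfun sfun pr <> 0 by apply/Rgt_not_eq/kfun_gt0.
  rewrite gweight_None.
  have -> : freed_rate pr t s * (gweight pr s / kfun sfun pr) =
    / kfun sfun pr * (freed_rate pr t s * gweight pr s) by rewrite /Rdiv; ring.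
  rewrite -IH // Rmult_plus_distr_l -Rmult_assoc Rinv_l // Rmult_1_l cats0; congr (_ + _).
    by apply: settle_ext => x; rewrite gweight_None gweight_Some.
  rewrite -dep_scal; congr (dep _ _ _ _ _ _ _).
  by apply: functional_extensionality => x; rewrite gweight_None /Rdiv Rmult_comm.
Qed.

(** Partial balance up to [eta] factors: departures into [s] match arrivals out of it. With no token
    ahead, [kfun [::] = 0] removes the extra term and no type is blocked. *)
Lemma sum_dep_gweight s : valid [::] s ->
  \sum_(t <- enum Tt) dep omU sfun [::] t tt s (gweight [::]) = total_rate * gweight [::] s.
Proof.
move=> v; rewrite (eq_bigr (fun t => freed_rate [::] t s * gweight [::] s)); last first.
  by move=> t _; rewrite -dep_gweight // kfun_nil; ring.
rewrite -big_distrl /=; congr (_ * _); have := sum_freed_rate v; rewrite /= => ->.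
rewrite lamUE big1; first ring.
move=> c _; case: ifP => // /subsetP h; case/set0Pn: (Tc_neq0 c) => t /h.
by rewrite inE.
Qed.

(** * Rates and level crossings *)

Notation level := (words (alphabet Ct Tt)).
Notation dep_flow x N y := (\sum_(q <- deps Tc sfun eta [::] x N) (if q.1 == y then q.2 else 0)).

Definition rate (s : seq (Ct * option Tt)) (e : Ct * option Tt) : R :=
  match e.2 with
  | None => if Tc e.1 \subset held s then lam e.1 else 0
  | Some t => if Tc e.1 \subset held s then 0 else lam e.1 * assign e.1 (held s) t
  end.

Definition arrival_flow (x y : seq (Ct * option Tt)) : R :=
  if y is e :: y' then (if x == belast e y' then rate x (last e y') else 0) else 0.

Lemma arrival_flow_rcons x y e : arrival_flow x (rcons y e) = if x == y then rate x e else 0.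
Proof. by case: y => [|a y] //=; rewrite belast_rcons last_rcons. Qed.

Lemma inrateE x y : inrate lam Tc assign sfun eta x y = arrival_flow x y + dep_flow x (size x) y.
Proof.
rewrite /inrate rsumE /trans !big_cat /= -Rplus_assoc; congr (_ + _).
rewrite big_map big_flatten big_map !big_filter /=.
rewrite [X in X + _]big_mkcond [X in _ + X]big_mkcond /= -big_split /=.
case/lastP: y => [|y [c o]].
  rewrite big1 // => c _; rewrite big_map /=.
  have nn (a : Ct * option Tt) : (rcons x a == [::]) = false by case: (x).
  rewrite nn [X in _ + (if _ then X else _)]big1 //; first by case: (_ \subset _) => /=; ring.
  by move=> t _; rewrite nn.
rewrite arrival_flow_rcons (bigD1_seq c) ?mem_enum ?enum_uniq //= [X in _ + X]big1; last first.
  move=> c' ne; rewrite big_map eqseq_rcons xpair_eqE (negbTE ne) /= andbF.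
  rewrite [X in _ + (if _ then X else _)]big1; first by case: (_ \subset _) => /=; ring.
  by move=> t _; rewrite eqseq_rcons xpair_eqE (negbTE ne) andbF.
rewrite Rplus_0_r big_map eqseq_rcons xpair_eqE eqxx /=.
have E t : (rcons x (c, Some t) == rcons y (c, o)) = (x == y) && (Some t == o).
  by rewrite eqseq_rcons xpair_eqE eqxx.
under eq_bigr do rewrite E.
case: (eqVneq x y) => [exy|_] /=; last first.
  by rewrite big1 //; case: (_ \subset _) => /=; ring.
subst x; case: o {E} => [t|] /=; rewrite /rate /=.
  rewrite (eq_bigr (fun i => if i == t then lam c * assign c (held y) i else 0)); last first.
    by move=> i _; rewrite (inj_eq Some_inj).
  rewrite sumR_uniq_pick ?enum_uniq ?mem_enum //.
  by case: ifP => _ /=; ring.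
by rewrite big1 //; case: ifP => _ /=; ring.
Qed.

Lemma size_give t s : size (give Tc t s) = size s.
Proof. by elim: s => //= e s IH; case: ifP => //= _; rewrite IH. Qed.

Lemma dep_flow_size y N x : forall pre, (size pre + size x)%N != (size y).+1 ->
  \sum_(q <- deps Tc sfun eta pre x N) (if q.1 == y then q.2 else 0) = 0.
Proof.
elim: x => [|e x IH] pre ne; first by rewrite big_nil.
rewrite /= big_cat /= IH; last by rewrite size_rcons addSnnS.
case: e.2 => [t|]; last by rewrite big_nil Rplus_0_r.
rewrite big_seq1 /=; case: eqP => [e'|]; last by rewrite Rplus_0_r.
by move: ne; rewrite -e' size_give size_cat /= addnS eqxx.
Qed.

Lemma sum_level_deps n N x : forall pre, (size pre + size x)%N = n.+1 ->
  \sum_(y <- level n) \sum_(q <- deps Tc sfun eta pre x N) (if q.1 == y then q.2 else 0)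
  = \sum_(q <- deps Tc sfun eta pre x N) q.2.
Proof.
elim: x => [|e x IH] pre h; first by rewrite big1 ?big_nil // => y _; rewrite big_nil.
rewrite /= big_cat /= -IH; last by rewrite size_rcons addSnnS.
under eq_bigr do rewrite big_cat.
rewrite big_split; congr (_ + _) => /=.
case: e.2 => [t|]; last by rewrite big_nil big1 // => y _; rewrite big_nil.
rewrite big_seq1 /=; under eq_bigr do rewrite big_seq1 /= eq_sym.
rewrite (sumR_uniq_pick (fun=> eta N * sfun (actv (rcons pre e)))) ?level_uniq //.
by rewrite mem_level size_give size_cat -eqSS -addnS h.
Qed.

Lemma sum_departures N x : forall pre, \sum_(q <- deps Tc sfun eta pre x N) q.2 =
  eta N * (kfun sfun (actv pre ++ actv x) - kfun sfun (actv pre)).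
Proof.
elim: x => [|[c o] x IH] pre /=; first by rewrite big_nil cats0; ring.
rewrite big_cat /= IH actv_rcons; case: o => [t|] /=.
  by rewrite big_seq1 /= cats1 cat_rcons kfun_rcons; ring.
by rewrite big_nil cats0; ring.
Qed.

Definition departure_rate (s : seq (Ct * option Tt)) : R := eta (size s) * kfun sfun (actv s).

Lemma sum_rate s : \sum_(e <- alphabet Ct Tt) rate s e = total_rate.
Proof.
rewrite sum_alphabet /rate /= exchange_big -big_split /=; apply: eq_bigr => c _.
case: (boolP (Tc c \subset held s)) => h; first by rewrite big1 // Rplus_0_r.
by rewrite -big_distrr /= sum_assign //; ring.
Qed.

Lemma outrateE s : outrate lam Tc assign sfun eta s = total_rate + departure_rate s.
Proof.
rewrite /outrate rsumE /trans !big_cat /= -Rplus_assoc sum_departures; congr (_ + _).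
  rewrite big_map big_flatten big_map [X in X + _]big_filter [X in _ + X]big_filter /=.
  rewrite -(sum_rate s) sum_alphabet; congr (_ + _); first by rewrite [LHS]big_mkcond.
  rewrite [RHS]exchange_big [LHS]big_mkcond; apply: eq_bigr => c _ /=; rewrite /rate /= big_map.
  by case: (_ \subset _) => //=; rewrite big1.
by rewrite kfun_nil /departure_rate /= Rminus_0_r.
Qed.

(** Contains every state that can enter [y]: [y] without its last customer for an arrival, the whole
    next level for a departure. *)
Definition sources (y : seq (Ct * option Tt)) : seq (seq (Ct * option Tt)) :=
  (if y is e :: y' then [:: belast e y'] else [::]) ++ level (size y).+1.

Lemma sources_uniq y : uniq (sources y).
Proof.
rewrite /sources; case: y => [|e y]; rewrite ?level_uniq //= level_uniq andbT mem_level.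
by rewrite size_belast neq_ltn leqnSn.
Qed.

Lemma inrate_sources x y : x \notin sources y -> inrate lam Tc assign sfun eta x y = 0.
Proof.
rewrite mem_cat negb_or mem_level inrateE => /andP[ne sz].
rewrite dep_flow_size ?add0n // Rplus_0_r.
by case: y ne {sz} => // e y; rewrite inE /= => /negbTE ->.
Qed.

Definition inflow (M : seq (Ct * option Tt) -> R) (y : seq (Ct * option Tt)) : R :=
  \sum_(x <- sources y) M x * inrate lam Tc assign sfun eta x y.

Lemma inflowE M y : inflow M y =
  (if y is e :: y' then M (belast e y') * rate (belast e y') (last e y') else 0) +
  \sum_(x <- level (size y).+1) M x * dep_flow x (size y).+1 y.
Proof.
rewrite /inflow /sources big_cat; congr (_ + _).
  case: y => [|e y]; rewrite ?big_nil // big_seq1 inrateE dep_flow_size /=.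
    by rewrite eqxx Rplus_0_r.
  by rewrite size_belast add0n neq_ltn leqnSn.
apply: eq_big_seq => x; rewrite mem_level => /eqP sx.
rewrite inrateE sx; suff -> : arrival_flow x y = 0 by rewrite Rplus_0_l.
case: y sx => //= e y sx; case: eqP => // ex.
by move: sx; rewrite ex size_belast => /eqP; rewrite -[X in X == _]addn0 -addn2 eqn_add2l.
Qed.

Lemma sum_level_rcons n F :
  \sum_(y <- level n.+1) F y = \sum_(x <- level n) \sum_(e <- alphabet Ct Tt) F (rcons x e).
Proof.
elim: n F => [|n IH] F.
  by rewrite sum_words_S big_seq1; apply: eq_bigr => e _; rewrite big_seq1.
by rewrite !sum_words_S; apply: eq_bigr => e _; rewrite IH.
Qed.

Definition level_mass (M : seq (Ct * option Tt) -> R) n : R := \sum_(x <- level n) M x.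
Definition down_flow (M : seq (Ct * option Tt) -> R) n : R :=
  \sum_(x <- level n) M x * departure_rate x.

Lemma sum_dep_flow M n :
  \sum_(y <- level n) \sum_(x <- level n.+1) M x * dep_flow x n.+1 y = down_flow M n.+1.
Proof.
rewrite exchange_big; apply: eq_big_seq => x; rewrite mem_level => /eqP sx /=.
rewrite -big_distrr /= sum_level_deps ?sx ?add0n // sum_departures kfun_nil.
by rewrite /departure_rate sx /= Rminus_0_r.
Qed.

Lemma inflow_nil M : inflow M [::] = down_flow M 1.
Proof. by rewrite inflowE -sum_dep_flow big_seq1 Rplus_0_l. Qed.

Lemma sum_inflow M n :
  \sum_(y <- level n.+1) inflow M y = total_rate * level_mass M n + down_flow M n.+2.
Proof.
under eq_bigr do rewrite inflowE; rewrite big_split /=; congr (_ + _).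
  rewrite sum_level_rcons /level_mass big_distrr; apply: eq_bigr => x _ /=.
  rewrite -(sum_rate x) big_distrl; apply: eq_bigr => e _ /=.
  by case: x => [|a x] /=; rewrite ?belast_rcons ?last_rcons /= Rmult_comm.
rewrite -sum_dep_flow; apply: eq_big_seq => y; rewrite mem_level => /eqP -> //.
Qed.

Lemma sum_outflow M n : \sum_(y <- level n) M y * outrate lam Tc assign sfun eta y =
  total_rate * level_mass M n + down_flow M n.
Proof.
rewrite /level_mass big_distrr -big_split; apply: eq_bigr => y _ /=.
by rewrite outrateE; ring.
Qed.

(* The balance equations at levels 1, ..., n+1 telescope into a level-crossing balance. *)
Lemma level_crossing M :
  (forall n, \sum_(y <- level n.+1) inflow M y =
     \sum_(y <- level n.+1) M y * outrate lam Tc assign sfun eta y) ->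
  forall n, down_flow M n.+1 = total_rate * level_mass M n + (down_flow M 1 - total_rate * M [::]).
Proof.
move=> h; elim=> [|n IH]; first by rewrite /level_mass big_seq1; ring.
by have := h n; rewrite sum_inflow sum_outflow IH; lra.
Qed.

(** * The intertwining identity and the minimal solution of the balance equations *)

(** A waiting arrival has factor 1 because its rate is already the kernel weight of the new
    entry. *)
Definition arr (X : Type) (a : X -> seq Tt -> Tt -> R) (h : seq (option (X * Tt)) -> R)
    (k : seq (option (X * Tt))) : R :=
  if k is o :: k' then
    h (belast o k') * (if last o k' is Some (c, t) then a c (toks (belast o k')) t else 1)
  else 0.

Lemma arr_rcons X a h (k : seq (option (X * Tt))) o : arr a h (rcons k o) =
  h k * (if o is Some (c, t) then a c (toks k) t else 1).
Proof. by case: k => [|b k] //=; rewrite belast_rcons last_rcons. Qed.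

Definition claim_rate (c : Ct) (pr : seq Tt) (t : Tt) : R := lam c * assign c [set x in pr] t.
Definition claim_sum (_ : unit) (pr : seq Tt) (t : Tt) : R := lamt lam assign [set x in pr] t.

(** Relative to [eta_weight] at the level of [k], an arrival comes from one level below and picks up
    [eta (size k)], while a departure from one level above has its [eta] absorbed. *)
Definition state_flow (h : seq (option (Ct * Tt)) -> R) k : R :=
  eta (size k) * arr claim_rate h k +
  \sum_(t <- enum Tt) \sum_(c <- enum Ct) dep (om lam Tc) sfun [::] t c k h.

Definition token_flow (g : seq (option (unit * Tt)) -> R) s : R :=
  eta (size s) * arr claim_sum g s + \sum_(t <- enum Tt) dep omU sfun [::] t tt s g.

Definition exit_rate (X : Type) (k : seq (option (X * Tt))) : R :=
  total_rate + eta (size k) * kfun sfun (toks k).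

Definition eta_weight (n : nat) : R := rprod (iota 1 n) (fun m => / eta m).

Lemma eta_weightS n : eta_weight n.+1 = eta_weight n * / eta n.+1.
Proof.
have e : iota 1 n.+1 = iota 1 n ++ [:: n.+1] by rewrite -[in LHS](addn1 n) iotaD add1n.
by rewrite /eta_weight !rprodE e big_cat big_seq1.
Qed.

Lemma eta_weight_gt0 n : 0 < eta_weight n.
Proof.
elim: n => [|n IH]; first by rewrite /eta_weight /=; lra.
by rewrite eta_weightS; apply/Rmult_lt_0_compat/Rinv_0_lt_compat/eta_gt0.
Qed.

Lemma eta_weight_eta n : eta_weight n.+1 * eta n.+1 = eta_weight n.
Proof.
by rewrite eta_weightS Rmult_assoc Rinv_l ?Rmult_1_r //; apply/Rgt_not_eq/eta_gt0.
Qed.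

Notation wt := (weight lam Tc).

Definition mass (h : seq (option (Ct * Tt)) -> R) (s : seq (Ct * option Tt)) : R :=
  eta_weight (size s) * (wt [::] s * h (sk s)).

(** The assignment rule gives no mass to held tokens, hence none at all for blocked types, so the
    kernel's cases agree with those of the arrival rate. *)
Lemma weight1_rate y e : weight1 lam Tc (actv y) e *
    (if skE e is Some (c, t) then claim_rate c (actv y) t else 1) = rate y e.
Proof.
rewrite /weight1 /rate /claim_rate held_actv /skE; case: e => c [t|] /=; last by ring.
case: ifP => [tin|_].
  by rewrite assign_out ?Rmult_0_r; [case: ifP => _; ring | rewrite !inE tin].
case: ifP => [/subsetP sub|_]; last by ring.
rewrite assign_out ?Rmult_0_r //; rewrite !inE; apply/negP => /andP[tn tc].
by have := sub t tc; rewrite inE (negbTE tn).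
Qed.

(** The intertwining identity: one step of the detailed chain keeps the form kernel times skeleton
    function. *)
Lemma inflow_mass h y :
  inflow (mass h) y = eta_weight (size y) * (wt [::] y * state_flow h (sk y)).
Proof.
rewrite inflowE /state_flow !Rmult_plus_distr_l; congr (_ + _); last first.
  rewrite -(eta_weight_eta (size y)) Rmult_assoc -departures_into big_distrr.
  apply: eq_big_seq => x; rewrite mem_level => /eqP sx.
  by rewrite /mass sx /= !Rmult_assoc.
case/lastP: y => [|y e]; first by rewrite /=; ring.
have -> : (if rcons y e is a :: y' then mass h (belast a y') * rate (belast a y') (last a y')
   else 0) = mass h y * rate y e by case: y => [|a y] //=; rewrite belast_rcons last_rcons.
rewrite size_rcons /sk map_rcons arr_rcons size_rcons -/(sk y) weight_rcons toks_sk.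
rewrite -weight1_rate size_map /mass.
have -> : eta_weight (size y) = eta_weight (size y).+1 * eta (size y).+1.
  by rewrite eta_weight_eta.
rewrite cat0s; move: (if skE e is Some _ then _ else _) => a; ring.
Qed.

Lemma weight1_ge0 pr e : 0 <= weight1 lam Tc pr e.
Proof.
rewrite /weight1; case: e.2 => [t|]; case: ifP => _; try lra.
by have := lam_gt0 e.1; lra.
Qed.

Lemma weight_ge0 s : forall pr, 0 <= wt pr s.
Proof.
elim: s => [|e s IH] pr /=; first lra.
by apply: Rmult_le_pos => //; apply: weight1_ge0.
Qed.

Lemma weight_valid s : forall pr, wt pr s <> 0 -> valid pr (sk s).
Proof.
elim: s => //= -[c [t|]] s IH pr w0 /=.
  rewrite /weight1 /= in w0; case tp: (t \in pr) w0 => /= w0; first by case: w0; ring.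
  by rewrite -cats1; apply: IH => e; apply: w0; rewrite e; ring.
rewrite /weight1 /= cats0 in w0.
rewrite [valid pr (sk s)]IH ?andbT; last by move=> e; apply: w0; rewrite e; ring.
case: ifP w0 => [/subsetP sub _|_ w0]; last by case: w0; ring.
by case/set0Pn: (Tc_neq0 c) => t /sub; rewrite inE; case: (pr).
Qed.

Lemma weight_uniq s : wt [::] s <> 0 -> uniq (actv s).
Proof. by move=> /weight_valid /(valid_uniq (pr := [::]) isT); rewrite toks_sk. Qed.

Lemma total_rate_ge0 : 0 <= total_rate.
Proof. by apply: sumR_ge0 => c _; apply/Rlt_le/lam_gt0. Qed.

Lemma valid_toks (X : eqType) (k : seq (option (X * Tt))) : valid [::] k -> k != [::] -> toks k != [::].
Proof. by case: k => [|[[c t]|] k]. Qed.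

Lemma level_down_gt0 (X : eqType) (k : seq (option (X * Tt))) : valid [::] k -> k != [::] ->
  0 < eta (size k) * kfun sfun (toks k).
Proof.
move=> v ne; apply: Rmult_lt_0_compat; first by apply: eta_gt0; rewrite lt0n size_eq0.
by apply: kfun_gt0; [apply: (valid_uniq (pr := [::])) | apply: valid_toks].
Qed.

Lemma exit_rate_gt0 (X : eqType) (k : seq (option (X * Tt))) : valid [::] k -> k != [::] -> 0 < exit_rate k.
Proof. by move=> v ne; have := level_down_gt0 v ne; have := total_rate_ge0; rewrite /exit_rate; lra. Qed.

Lemma outrate_exit y : outrate lam Tc assign sfun eta y = exit_rate (sk y).
Proof. by rewrite outrateE /exit_rate /departure_rate toks_sk size_map. Qed.

Lemma arr_le X (a : X -> seq Tt -> Tt -> R) k h h' : (forall c pr t, 0 <= a c pr t) ->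
  valid [::] k -> (forall x, valid [::] x -> h x <= h' x) -> arr a h k <= arr a h' k.
Proof.
move=> a0; case/lastP: k => [|k o]; first by rewrite /=; lra.
rewrite valid_rcons !arr_rcons => /andP[v _] hh; apply: Rmult_le_compat_r; last exact: hh.
by case: o => [[c t]|]; [apply: a0 | lra].
Qed.

Lemma eta_arr_le X (a : X -> seq Tt -> Tt -> R) k h h' : (forall c pr t, 0 <= a c pr t) ->
  valid [::] k -> (forall x, valid [::] x -> h x <= h' x) ->
  eta (size k) * arr a h k <= eta (size k) * arr a h' k.
Proof.
move=> a0 v hh; case: k v => [|o k] v; first by rewrite /=; lra.
by apply: Rmult_le_compat_l; [apply/Rlt_le/eta_gt0 | apply: arr_le].
Qed.

Lemma state_flow_le k h h' : valid [::] k -> (forall x, valid [::] x -> h x <= h' x) ->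
  state_flow h k <= state_flow h' k.
Proof.
move=> v hh; apply: Rplus_le_compat.
  apply: eta_arr_le => // c pr t; rewrite /claim_rate.
  by have := lam_gt0 c; have := assign_ge0 c [set x in pr] t; nra.
apply: sumR_le => t _; apply: sumR_le => c _.
by apply: dep_le => //; [apply: om_ge0 | apply: sfun_ge0].
Qed.

Lemma token_flow_le s g g' : valid [::] s -> (forall x, valid [::] x -> g x <= g' x) ->
  token_flow g s <= token_flow g' s.
Proof.
move=> v hh; apply: Rplus_le_compat.
  by apply: eta_arr_le => // c pr t; apply: lamt_ge0.
apply: sumR_le => t _.
by apply: dep_le => //; [apply: om_sum_ge0 | apply: sfun_ge0].
Qed.

Lemma state_flow_fills s h : \sum_(k <- fills Ct s) state_flow h k =
  token_flow (fun s' => \sum_(k <- fills Ct s') h k) s.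
Proof.
rewrite /state_flow big_split /=; congr (_ + _); last first.
  by rewrite exchange_big; apply: eq_bigr => t _; rewrite dep_fills.
rewrite (eq_big_seq (fun k => eta (size s) * arr claim_rate h k)); last first.
  by move=> k /size_fills ->.
rewrite -big_distrr /=; congr (_ * _).
case/lastP: s => [|s o]; first by rewrite big_seq1.
rewrite sum_fills_rcons arr_rcons big_distrl; apply: eq_big_seq => k kin /=.
case: o => [[u t]|] /=; last by rewrite big_seq1 arr_rcons.
rewrite big_map /claim_sum lamtE big_distrr; apply: eq_bigr => c _ /=.
by rewrite arr_rcons /claim_rate (toks_fills kin).
Qed.

Notation gw := (gweight [::]).

(** Two partial balances: departures in against arrivals out, and arrivals in against departures
    out. The second holds because the last customer multiplies [gw] by its claim rate, or by 1 if it
    waits, and divides it by [kfun]. *)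
Lemma token_flow_gweight s : valid [::] s -> token_flow gw s = exit_rate s * gw s.
Proof.
move=> v; rewrite /token_flow sum_dep_gweight // /exit_rate.
suff -> : eta (size s) * arr claim_sum gw s = eta (size s) * kfun sfun (toks s) * gw s by ring.
case/lastP: s v => [|s o]; first by rewrite /= kfun_nil => _; ring.
move=> v; have kn : kfun sfun (toks (rcons s o)) <> 0.
  apply/Rgt_not_eq/kfun_gt0; first exact: (valid_uniq (pr := [::])).
  by apply: valid_toks => //; case: (s).
rewrite arr_rcons /gweight !cat0s kweight_rcons.
have -> : tok o = toks [:: o] by rewrite /= cats0.
rewrite cat0s -toks_cat cats1 [RHS]Rmult_assoc; congr (_ * _).
have -> : prodlam lam assign (toks (rcons s o)) = prodlam lam assign (toks s) *
    (if o is Some (c, t) then claim_sum c (toks s) t else 1).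
  rewrite -cats1 toks_cat; case: o {v kn} => [[c t]|] /=; last by rewrite cats0; ring.
  by rewrite cats1 prodlam_rcons.
by field.
Qed.

(** Invalid skeletons get 0, since [exit_rate] need not be positive there. *)
Fixpoint approx (n : nat) (k : seq (option (Ct * Tt))) : R :=
  match n, k with
  | 0%N, _ => 0
  | n'.+1, [::] => 1
  | n'.+1, _ => if valid [::] k then state_flow (approx n') k / exit_rate k else 0
  end.

Lemma approx_invalid n k : ~~ valid [::] k -> approx n k = 0.
Proof. by case: n k => [|n] [|o k] // /negbTE /= ->. Qed.

Lemma approxS n k : k != [::] -> valid [::] k ->
  approx n.+1 k = state_flow (approx n) k / exit_rate k.
Proof.
case: k => // o k _ v.
rewrite -[approx _ _]/(if valid [::] (o :: k)
  then state_flow (approx n) (o :: k) / exit_rate (o :: k) else 0).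
by rewrite v.
Qed.

Lemma approx_le n : forall k, approx n k <= approx n.+1 k.
Proof.
elim: n => [|n IH] k.
  case: (eqVneq k [::]) => [->|ne]; first by rewrite /=; lra.
  case: (boolP (valid [::] k)) => v; last by rewrite !approx_invalid //; lra.
  rewrite approxS //; apply: Rmult_le_pos; last exact/Rlt_le/Rinv_0_lt_compat/exit_rate_gt0.
  rewrite /state_flow; apply: Rplus_le_le_0_compat.
    by case/lastP: k {ne v} => [|k o]; rewrite ?arr_rcons /=; right; ring.
  right; rewrite big1 // => t _; rewrite big1 // => c _.
  have -> : approx 0 = (fun x => 0 * 0) by apply: functional_extensionality => x; rewrite Rmult_0_l.
  by rewrite dep_scal Rmult_0_l.
case: (eqVneq k [::]) => [->|ne]; first by rewrite /=; lra.
case: (boolP (valid [::] k)) => v; last by rewrite !approx_invalid //; lra.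
rewrite (approxS n) // (approxS n.+1) //; apply: Rmult_le_compat_r.
  exact/Rlt_le/Rinv_0_lt_compat/exit_rate_gt0.
exact: state_flow_le.
Qed.

Lemma approx_ge0 n k : 0 <= approx n k.
Proof.
elim: n => [|n IH]; first by rewrite /=; lra.
by have := approx_le n k; lra.
Qed.

(** [gw] solves the equations summed over holder types, so a monotone iteration started below it
    stays below. *)
Lemma sum_approx_le n s : valid [::] s -> \sum_(k <- fills Ct s) approx n k <= gw s.
Proof.
elim: n s => [|n IH] s v.
  by rewrite big1 //; apply: gweight_ge0.
case: (eqVneq s [::]) => [->|ne].
  by rewrite big_seq1 /gweight /prodlam /=; lra.
rewrite (eq_big_seq (fun k => state_flow (approx n) k * / exit_rate s)).
  rewrite -big_distrl /= state_flow_fills.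
  have e0 := exit_rate_gt0 v ne.
  apply: (Rmult_le_reg_r (exit_rate s)) => //.
  rewrite Rmult_assoc Rinv_l ?Rmult_1_r; last exact: Rgt_not_eq.
  rewrite (Rmult_comm (gw s)) -token_flow_gweight //.
  by apply: token_flow_le.
move=> k kin; rewrite approxS.
- by rewrite /exit_rate (size_fills kin) (toks_fills kin).
- by rewrite -size_eq0 (size_fills kin) size_eq0.
- by rewrite (valid_fills _ kin).
Qed.

Definition strip (k : seq (option (Ct * Tt))) : seq (option (unit * Tt)) :=
  map (omap (fun q => (tt, q.2))) k.

Lemma mem_fills_strip k : k \in fills Ct (strip k).
Proof.
elim: k => [|o k IH]; first by rewrite inE.
apply/allpairsP; exists (o, k); split => //=.
case: o => [[c t]|] /=; last by rewrite inE.
by apply/mapP; exists c; rewrite ?mem_enum.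
Qed.

Lemma valid_strip k : valid [::] (strip k) = valid [::] k.
Proof. by rewrite (valid_fills _ (mem_fills_strip k)). Qed.

(** [Rmax 0] covers invalid skeletons, for which the sign of [gw] is not controlled. *)
Lemma approx_bound n k : approx n k <= Rmax 0 (gw (strip k)).
Proof.
case: (boolP (valid [::] k)) => v; last by rewrite approx_invalid //; apply: Rmax_l.
apply: Rle_trans (Rmax_r _ _); rewrite -valid_strip in v.
apply: Rle_trans (sum_approx_le n v).
by apply: (sumR_mem_le (F := approx n)) (mem_fills_strip k) => x _; apply: approx_ge0.
Qed.

Lemma approx_cv k : { l | Un_cv (fun n => approx n k) l }.
Proof.
apply: growing_cv; first by move=> n; apply: approx_le.
by exists (Rmax 0 (gw (strip k))) => _ [n ->]; apply: approx_bound.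
Qed.

Definition minimal (k : seq (option (Ct * Tt))) : R := sval (approx_cv k).

Lemma minimal_cv k : Un_cv (fun n => approx n k) (minimal k).
Proof. exact: (svalP (approx_cv k)). Qed.

Lemma Un_cv_shift (u : nat -> R) l : Un_cv u l -> Un_cv (fun n => u n.+1) l.
Proof. by move=> h e /h[N hN]; exists N => n hn; apply: hN; apply/leP/leqW/leP. Qed.

Lemma Un_cv_cst (a : R) : Un_cv (fun=> a) a.
Proof. by move=> e e0; exists 0%N => n _; rewrite /R_dist Rminus_diag Rabs_R0. Qed.

Lemma Un_cv_le (u : nat -> R) l b : Un_cv u l -> (forall n, u n <= b) -> l <= b.
Proof. by move=> hu ub; apply: (Rle_cv_lim ub hu); apply: Un_cv_cst. Qed.

Lemma minimal_ge0 k : 0 <= minimal k.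
Proof.
apply: (@Rle_cv_lim (fun=> 0) (fun n => approx n k)) (minimal_cv k).
  by move=> n; apply: approx_ge0.
exact: Un_cv_cst.
Qed.

Lemma minimal_nil : minimal [::] = 1.
Proof.
apply: UL_sequence (Un_cv_shift (minimal_cv [::])) _.
exact: Un_cv_cst.
Qed.

Lemma mass_cv s : Un_cv (fun n => mass (approx n) s) (mass minimal s).
Proof.
apply: CV_mult; first exact: Un_cv_cst.
by apply: CV_mult; [apply: Un_cv_cst | apply: minimal_cv].
Qed.

Lemma mass_approxS n y : y != [::] ->
  mass (approx n.+1) y * outrate lam Tc assign sfun eta y = inflow (mass (approx n)) y.
Proof.
move=> ne; rewrite inflow_mass /mass; case: (Req_dec (wt [::] y) 0) => [->|/weight_valid v].
  by ring.
have ne' : sk y != [::] by rewrite -size_eq0 size_map size_eq0.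
rewrite approxS // outrate_exit /Rdiv !Rmult_assoc Rinv_l ?Rmult_1_r //.
by apply/Rgt_not_eq/exit_rate_gt0.
Qed.

(** There are finitely many sources, so the recursion passes to the limit. The empty state is
    excluded because its value was prescribed. *)
Lemma minimal_balance y : y != [::] ->
  inflow (mass minimal) y = mass minimal y * outrate lam Tc assign sfun eta y.
Proof.
move=> ne.
have h1 : Un_cv (fun n => inflow (mass (approx n)) y) (inflow (mass minimal) y).
  apply: Un_cv_bigsum => x; apply: CV_mult; [exact: mass_cv | exact: Un_cv_cst].
apply: UL_sequence h1 _.
have h2 : Un_cv (fun n => mass (approx n.+1) y * outrate lam Tc assign sfun eta y)
    (mass minimal y * outrate lam Tc assign sfun eta y).
  by apply: CV_mult; [apply: (Un_cv_shift (mass_cv y)) | apply: Un_cv_cst].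
move=> e /h2[N hN]; exists N => n /hN; rewrite mass_approxS //.
Qed.

Lemma sum_minimal_le s : valid [::] s -> \sum_(k <- fills Ct s) minimal k <= gw s.
Proof.
move=> v; apply: (@Un_cv_le (fun n => \sum_(k <- fills Ct s) approx n k)).
  by apply: Un_cv_bigsum => k; apply: minimal_cv.
by move=> n; apply: sum_approx_le.
Qed.

Lemma mass_minimal_ge0 s : 0 <= mass minimal s.
Proof.
apply: Rmult_le_pos; first exact/Rlt_le/eta_weight_gt0.
by apply: Rmult_le_pos; [apply: weight_ge0 | apply: minimal_ge0].
Qed.

(** * Every stationary distribution is a multiple of the minimal solution *)

Fixpoint nonneg_rates (l : seq (seq (Ct * option Tt) * R)) : Prop :=
  if l is q :: l' then 0 <= q.2 /\ nonneg_rates l' else True.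

Lemma nonneg_rates_cat l1 l2 : nonneg_rates l1 -> nonneg_rates l2 -> nonneg_rates (l1 ++ l2).
Proof. by elim: l1 => //= q l IH [q0 h] h2; split=> //; apply: IH. Qed.

Lemma nonneg_rates_map (X : Type) (l : seq X) f :
  (forall x, 0 <= (f x).2) -> nonneg_rates (map f l).
Proof. by move=> h; elim: l. Qed.

Lemma nonneg_rates_flatten (X : Type) (l : seq X) f :
  (forall x, nonneg_rates (f x)) -> nonneg_rates (flatten (map f l)).
Proof. by move=> h; elim: l => //= x l IH; apply: nonneg_rates_cat. Qed.

Lemma nonneg_rates_trans x : uniq (actv x) -> nonneg_rates (trans lam Tc assign sfun eta x).
Proof.
move=> u; apply: nonneg_rates_cat.
  by apply: nonneg_rates_map => c; apply/Rlt_le/lam_gt0.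
apply: nonneg_rates_cat.
  apply: nonneg_rates_flatten => c; apply: nonneg_rates_map => t /=.
  by have := lam_gt0 c; have := assign_ge0 c (held x) t; nra.
case: x u => [|a x] // u.
have := eta_gt0 (ltn0Sn (size x)); rewrite -/(size (a :: x)).
(* The rates involve the size of the whole state, which is frozen before the induction over suffixes
   behind an arbitrary prefix. *)
move: (size (a :: x)) => N eN; rewrite -[actv _]cat0s -[[::]]/(actv (@nil (Ct * option Tt))) in u.
elim: (a :: x) [::] u => {a x} [|[c o] x IH] pre u //.
have u' : uniq (actv (rcons pre (c, o)) ++ actv x).
  by rewrite actv_rcons; case: o u => [t|] /=; rewrite ?cats0 // -catA.
apply: nonneg_rates_cat; last exact: IH.
case: o u' {u} => [t|] //= u; split=> //.
apply: Rmult_le_pos; first exact: Rlt_le.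
by apply: sfun_ge0; move: u; rewrite cat_uniq => /andP[].
Qed.

Lemma nonneg_rates_sum l y : nonneg_rates l -> 0 <= rsum l (fun q => if q.1 == y then q.2 else 0).
Proof. by elim: l => [|q l IH] /=; [lra | case=> q0 /IH; case: eqP => _; lra]. Qed.

Lemma nonneg_rates_In l y r : nonneg_rates l -> List.In (y, r) l ->
  r <= rsum l (fun q => if q.1 == y then q.2 else 0).
Proof.
elim: l => [|q l IH] //= [q0 h] [->|/(IH h)] /=.
  by rewrite eqxx; have := nonneg_rates_sum y h; lra.
by case: eqP => _; lra.
Qed.

Lemma inrate_ge0 x y : uniq (actv x) -> 0 <= inrate lam Tc assign sfun eta x y.
Proof. by move=> u; apply/nonneg_rates_sum/nonneg_rates_trans. Qed.

Lemma inflow_term_le M y x : (forall s, 0 <= M s) -> (forall s, M s <> 0 -> uniq (actv s)) ->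
  M x * inrate lam Tc assign sfun eta x y <= inflow M y.
Proof.
move=> M0 Mu; have term0 s : 0 <= M s * inrate lam Tc assign sfun eta s y.
  case: (Req_dec (M s) 0) => [->|/Mu u]; first by rewrite Rmult_0_l; lra.
  by apply: Rmult_le_pos => //; apply: inrate_ge0.
case: (boolP (x \in sources y)) => [xin|xn].
  exact: (sumR_mem_le (F := fun x => M x * inrate lam Tc assign sfun eta x y)) xin.
by rewrite inrate_sources // Rmult_0_r; apply: sumR_ge0.
Qed.

(* Reachability preserves the support of the weight, since by intertwining the flow into y is a
   multiple of the weight of y. *)
Lemma reach_weight s : reach lam Tc assign sfun eta s -> 0 < wt [::] s.
Proof.
elim=> [|x y r _ wx xy r0]; first by rewrite /=; lra.
have M0 u : 0 <= mass (fun=> 1) u.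
  apply: Rmult_le_pos; first exact/Rlt_le/eta_weight_gt0.
  by have := weight_ge0 u [::]; lra.
have Mu u : mass (fun=> 1) u <> 0 -> uniq (actv u).
  by move=> h; apply: weight_uniq => e; apply: h; rewrite /mass e; ring.
have := inflow_term_le y x M0 Mu; rewrite inflow_mass.
have ux : uniq (actv x) by apply: weight_uniq; lra.
have rin := nonneg_rates_In (nonneg_rates_trans ux) xy; rewrite -/(inrate _ _ _ _ _ x y) in rin.
have mx : 0 < mass (fun=> 1) x.
  by rewrite /mass Rmult_1_r; apply: Rmult_lt_0_compat => //; apply: eta_weight_gt0.
have := Rmult_lt_0_compat _ _ mx (Rlt_le_trans _ _ _ r0 rin).
move=> h1 h2; case: (Rle_lt_or_eq_dec _ _ (weight_ge0 y [::])) => // e.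
by move: h2; rewrite -e; lra.
Qed.

Section Stationary.
Variable p : seq (Ct * option Tt) -> R.
Hypothesis st : stationary lam Tc assign sfun eta p.

Lemma stationary_ge0 s : 0 <= p s.
Proof. exact: (proj1 st). Qed.

Lemma stationary_weight s : p s <> 0 -> 0 < wt [::] s.
Proof. by move=> h; apply/reach_weight/(proj1 (proj2 st)). Qed.

Lemma stationary_mass1 (F : seq (seq (Ct * option Tt))) : uniq F -> \sum_(x <- F) p x <= 1.
Proof.
by apply: sumR_le_infinite_sum stationary_ge0 _; apply: (proj1 (proj2 (proj2 st))).
Qed.

Lemma stationary_balance y : inflow p y = p y * outrate lam Tc assign sfun eta y.
Proof.
symmetry; apply: infinite_sum_finite (sources_uniq y) _ (proj2 (proj2 (proj2 st)) y).
by move=> x /inrate_sources ->; rewrite Rmult_0_r.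
Qed.

Lemma departure_rate_ge0 s : wt [::] s <> 0 -> 0 <= departure_rate s.
Proof.
case: s => [|e s] h; first by rewrite /departure_rate kfun_nil; lra.
apply: Rmult_le_pos; first exact/Rlt_le/eta_gt0.
exact/kfun_ge0/weight_uniq.
Qed.

Lemma departure_rate_gt0 s : wt [::] s <> 0 -> s != [::] -> 0 < departure_rate s.
Proof.
move=> /weight_valid v ne; have ne' : sk s != [::] by rewrite -size_eq0 size_map size_eq0.
by have := level_down_gt0 v ne'; rewrite toks_sk size_map.
Qed.

(** If a level has no mass, nothing flows down from the next one; as departure rates are positive on
    nonempty supported states, that level has no mass either. *)
Lemma level_crossing_zero M : (forall s, 0 <= M s) -> (forall s, M s <> 0 -> wt [::] s <> 0) ->
  M [::] = 0 -> (forall n, down_flow M n.+1 = total_rate * level_mass M n) ->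
  forall s, M s = 0.
Proof.
move=> M0 Mw Mnil h s; have all0 n : forall x, x \in level n -> M x = 0.
  elim: n => [|n IH] x; first by rewrite mem_level => /eqP/size0nil ->.
  have := h n; rewrite /level_mass big1_seq ?Rmult_0_r; last by move=> y /andP[_ /IH].
  move=> d0 xin; have term0 y : 0 <= M y * departure_rate y.
    case: (Req_dec (M y) 0) => [->|/Mw w]; first by rewrite Rmult_0_l; lra.
    by apply: Rmult_le_pos => //; apply: departure_rate_ge0.
  have e := sumR_eq0 (fun y _ => term0 y) d0 xin.
  case: (Req_dec (M x) 0) => // Mx; case/Rmult_integral: e => // e.
  have xne : x != [::] by move: xin; rewrite mem_level -size_eq0 => /eqP ->.
  by have := departure_rate_gt0 (Mw _ Mx) xne; lra.
by apply: (all0 (size s)); rewrite mem_level.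
Qed.

Lemma stationary_crossing n : down_flow p n.+1 = total_rate * level_mass p n.
Proof.
rewrite (@level_crossing p) => [|m]; last by apply: eq_bigr => y _; apply: stationary_balance.
have := stationary_balance [::]; rewrite inflow_nil outrateE /departure_rate kfun_nil => ->.
by ring.
Qed.

Lemma approx_stationary n s : p [::] * mass (approx n) s <= p s.
Proof.
elim: n s => [|n IH] s.
  by rewrite /mass /=; have := stationary_ge0 s; lra.
case: (eqVneq s [::]) => [->|ne].
  by rewrite /mass /eta_weight /=; lra.
case: (Req_dec (wt [::] s) 0) => [w0|w0].
  by rewrite /mass w0; have := stationary_ge0 s; lra.
have ne' : sk s != [::] by rewrite -size_eq0 size_map size_eq0.
have e0 := exit_rate_gt0 (weight_valid w0) ne'; rewrite -outrate_exit in e0.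
apply: (Rmult_le_reg_r (outrate lam Tc assign sfun eta s)) => //.
rewrite Rmult_assoc mass_approxS // -stationary_balance /inflow big_distrr.
apply: sumR_le => x _ /=; rewrite -Rmult_assoc.
(* At weight 0 the rates may have any sign, but both terms vanish; otherwise the tokens are distinct
   and [inrate] is nonnegative. *)
case: (Req_dec (wt [::] x) 0) => [wx|wx].
  have -> : p x = 0.
    by case: (Req_dec (p x) 0) => // /stationary_weight; lra.
  by rewrite /mass wx; lra.
by apply: Rmult_le_compat_r; [apply/inrate_ge0/weight_uniq | apply: IH].
Qed.

Lemma minimal_stationary_le s : p [::] * mass minimal s <= p s.
Proof.
apply: (@Un_cv_le (fun n => p [::] * mass (approx n) s)); last by move=> n; apply: approx_stationary.
by apply: CV_mult; [apply: Un_cv_cst | apply: mass_cv].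
Qed.

Lemma mass_minimal_nil : mass minimal [::] = 1.
Proof. by rewrite /mass minimal_nil /eta_weight /=; ring. Qed.

Lemma sum_level_mass_le1 N : \sum_(n <- iota 0 N) level_mass p n <= 1.
Proof.
have [F [u [_ <-]]] : exists F, uniq F /\ (forall x, x \in F -> (size x < N)%N) /\
    \sum_(x <- F) p x = \sum_(n <- iota 0 N) level_mass p n; last exact: stationary_mass1.
elim: N => [|N [F [u [sF e]]]]; first by exists [::]; rewrite !big_nil.
exists (F ++ level N); split; [|split].
- rewrite cat_uniq u level_uniq andbT /=; apply/hasPn => x; rewrite mem_level => /eqP sx.
  by apply/negP => /sF; rewrite sx ltnn.
- by move=> x; rewrite mem_cat mem_level => /orP[/sF/leqW//|/eqP ->].
- by rewrite -[in RHS](addn1 N) iotaD !big_cat e big_seq1.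
Qed.

Definition residue (s : seq (Ct * option Tt)) : R := p s - p [::] * mass minimal s.

Lemma residue_ge0 s : 0 <= residue s.
Proof. by have := minimal_stationary_le s; rewrite /residue; lra. Qed.

Lemma residue_le s : residue s <= p s.
Proof.
have := Rmult_le_pos _ _ (stationary_ge0 [::]) (mass_minimal_ge0 s).
by rewrite /residue; lra.
Qed.

Lemma residue_weight s : residue s <> 0 -> wt [::] s <> 0.
Proof.
move=> h w; apply: h; rewrite /residue /mass w.
have -> : p s = 0 by case: (Req_dec (p s) 0) => // /stationary_weight; lra.
by ring.
Qed.

Lemma residue_nil : residue [::] = 0.
Proof. by rewrite /residue mass_minimal_nil; ring. Qed.

Lemma residue_balance y : y != [::] ->
  inflow residue y = residue y * outrate lam Tc assign sfun eta y.
Proof.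
move=> ne; rewrite /residue Rmult_minus_distr_r -stationary_balance Rmult_assoc.
rewrite -minimal_balance // /inflow big_distrr -sumR_sub; apply: eq_bigr => x _ /=.
by ring.
Qed.

(* The net flow between levels is bounded by the upward flow of p, which is summable. *)
Lemma residue_crossing n : down_flow residue n.+1 = total_rate * level_mass residue n.
Proof.
have cr := @level_crossing residue.
have {}cr m : down_flow residue m.+1 =
    total_rate * level_mass residue m + down_flow residue 1.
  rewrite cr => [|k]; first by rewrite residue_nil; ring.
  by apply: eq_big_seq => y; rewrite mem_level => sy; apply: residue_balance; case: (y) sy.
have term0 y : 0 <= residue y * departure_rate y.
  case: (Req_dec (residue y) 0) => [->|/residue_weight w]; first by rewrite Rmult_0_l; lra.
  by apply: Rmult_le_pos; [apply: residue_ge0 | apply: departure_rate_ge0].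
have d0 : 0 <= down_flow residue 1 by apply: sumR_ge0.
suff : down_flow residue 1 = 0 by move=> h; rewrite (cr n) h; ring.
case: (Rle_lt_or_eq_dec _ _ d0) => // d1; exfalso.
have bnd m : down_flow residue 1 <= total_rate * level_mass p m.
  have l0 : 0 <= total_rate * level_mass residue m.
    apply: Rmult_le_pos; first exact: total_rate_ge0.
    by apply: sumR_ge0 => x _; apply: residue_ge0.
  suff : down_flow residue m.+1 <= down_flow p m.+1.
    by rewrite stationary_crossing; have := cr m; lra.
  apply: sumR_le => x _; case: (Req_dec (wt [::] x) 0) => w.
    have -> : residue x = 0 by case: (Req_dec (residue x) 0) => // /residue_weight.
    have -> : p x = 0 by case: (Req_dec (p x) 0) => // /stationary_weight; lra.
    by lra.
  by apply: Rmult_le_compat_r; [apply: departure_rate_ge0 | apply: residue_le].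
(* The first [N] levels each carry at least the constant net flow, while their total upward flow is
   at most [total_rate], as [p] has mass 1. *)
have bndN N : INR N * down_flow residue 1 <= total_rate.
  have : total_rate * \sum_(n <- iota 0 N) level_mass p n <= total_rate * 1.
    by apply: Rmult_le_compat_l; [apply: total_rate_ge0 | apply: sum_level_mass_le1].
  rewrite Rmult_1_r; apply: Rle_trans; rewrite [X in _ <= X]big_distrr /=.
  elim: N => [|N IH]; first by rewrite big_nil /= Rmult_0_l; right.
  have -> : \sum_(i <- iota 0 N.+1) total_rate * level_mass p i =
      \sum_(i <- iota 0 N) total_rate * level_mass p i + total_rate * level_mass p N.
    by rewrite -(addn1 N) iotaD big_cat big_seq1.
  rewrite S_INR.
  by rewrite Rmult_plus_distr_r Rmult_1_l; apply: Rplus_le_compat IH (bnd _).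
have [N hN] := INR_unbounded (total_rate / down_flow residue 1).
have := bndN N; apply: Rlt_not_le.
have -> : total_rate = total_rate / down_flow residue 1 * down_flow residue 1 by field; lra.
by apply: Rmult_lt_compat_r.
Qed.

Lemma stationary_minimal s : p s = p [::] * mass minimal s.
Proof.
have := level_crossing_zero residue_ge0 residue_weight residue_nil residue_crossing s.
by rewrite /residue; lra.
Qed.

Lemma stationary_nil_gt0 : 0 < p [::].
Proof.
case: (Rle_lt_or_eq_dec _ _ (stationary_ge0 [::])) => // e; exfalso.
have p0 s : p s = 0 by rewrite stationary_minimal -e; ring.
have h := @infinite_sum_finite _ p 1 [::] isT (fun x _ => p0 x) (proj1 (proj2 (proj2 st))).
by move: h; rewrite big_nil; lra.
Qed.

(** * The token process has the product form *)

(* Expands prodlam over the types of the token holders. *)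
Fixpoint holders (pr : seq Tt) (k : seq (option (Ct * Tt))) : R :=
  match k with
  | [::] => 1
  | None :: k' => holders pr k'
  | Some (c, t) :: k' => claim_rate c pr t * holders (rcons pr t) k'
  end.

(** A lift of [gw] to typed skeletons, making [level_crossing], stated for detailed states,
    applicable. Only its sums over holder types matter; it need not be the stationary weight
    itself. *)
Definition product_form (k : seq (option (Ct * Tt))) : R :=
  holders [::] k * kweight [::] (strip k).

Lemma sum_holders s : forall pr,
  \sum_(k <- fills Ct s) holders pr k = prodlam_aux lam assign pr (toks s).
Proof.
elim: s => [|[[u t]|] s IH] pr; first by rewrite big_seq1.
  rewrite sum_fills_cons big_map /= lamtE big_distrl; apply: eq_bigr => c _ /=.
  by rewrite -big_distrr IH.
by rewrite sum_fills_cons big_seq1 /= IH.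
Qed.

Lemma strip_fills s k : k \in fills Ct s -> strip k = s.
Proof.
elim: s k => [|o s IH] k; first by rewrite inE => /eqP ->.
case/allpairsP => -[a k'] [/= ao /IH e ->] /=; rewrite e; congr (_ :: _).
by case: o ao => [[[] t]|] /=; [case/mapP=> c _ -> | rewrite inE => /eqP ->].
Qed.

Lemma sum_product_form s : \sum_(k <- fills Ct s) product_form k = gw s.
Proof.
rewrite /gweight /prodlam /= -sum_holders big_distrl; apply: eq_big_seq => k /strip_fills e.
by rewrite /product_form e.
Qed.

Fixpoint token_weight (pr : seq Tt) (s : seq (option (unit * Tt))) : R :=
  match s with
  | [::] => 1
  | None :: s' => lamU lam Tc [set x in pr] * token_weight pr s'
  | Some (_, t) :: s' => (if t \in pr then 0 else 1) * token_weight (rcons pr t) s'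
  end.

Lemma token_weight_ge0 s : forall pr, 0 <= token_weight pr s.
Proof.
elim: s => [|[[u t]|] s IH] pr /=; first lra.
  by apply: Rmult_le_pos => //; case: ifP => _; lra.
apply: Rmult_le_pos => //; rewrite lamUE; apply: sumR_ge0 => c _.
by have := lam_gt0 c; case: ifP => _; lra.
Qed.

Lemma token_weight_valid s : forall pr, token_weight pr s <> 0 -> valid pr s.
Proof.
elim: s => [|[[u t]|] s IH] pr //=.
  case: (t \in pr) => w0; first by case: w0; ring.
  by apply: IH => e; apply: w0; rewrite e; ring.
move=> w0; rewrite IH ?andbT; last by move=> e; apply: w0; rewrite e; ring.
apply/eqP => e; apply: w0; rewrite e lamUE big1; first ring.
move=> c _; case: ifP => // /subsetP h; case/set0Pn: (Tc_neq0 c) => t /h.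
by rewrite inE.
Qed.

Definition token_alphabet : seq (option (unit * Tt)) :=
  None :: [seq Some (tt, t) | t <- enum Tt].

Lemma sum_level_tokens n : forall pr H,
  \sum_(y <- level n) wt pr y * H (sk y) =
  \sum_(s <- words token_alphabet n) token_weight pr s * \sum_(k <- fills Ct s) H k.
Proof.
elim: n => [|n IH] pr H; first by rewrite !big_seq1 /=.
rewrite !sum_words_S sum_alphabet [RHS]big_cons [X in _ = _ + X]big_map; congr (_ + _).
  transitivity (\sum_(c <- enum Ct) weight1 lam Tc pr (c, None) *
      \sum_(s <- words token_alphabet n) token_weight pr s * \sum_(k <- fills Ct s) H (None :: k)).
    apply: eq_bigr => c _; rewrite -(IH pr (fun k => H (None :: k))) big_distrr.
    by apply: eq_bigr => y _; rewrite /= cats0 Rmult_assoc.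
  rewrite -big_distrl -lamUE big_distrr /=; apply: eq_bigr => s _.
  by rewrite sum_fills_cons big_seq1 Rmult_assoc.
apply: eq_bigr => t _.
transitivity (\sum_(c <- enum Ct) (if t \in pr then 0 else 1) *
    \sum_(s <- words token_alphabet n) token_weight (rcons pr t) s *
      \sum_(k <- fills Ct s) H (Some (c, t) :: k)).
  apply: eq_bigr => c _; rewrite -(IH (rcons pr t) (fun k => H (Some (c, t) :: k))) big_distrr.
  by apply: eq_bigr => y _; rewrite /= cats1 Rmult_assoc.
rewrite -big_distrr exchange_big big_distrr /=; apply: eq_bigr => s _.
by rewrite sum_fills_cons /fill1 [in RHS]big_map [RHS]Rmult_assoc -[in LHS]big_distrr.
Qed.

Lemma sum_level_mass h n (f : nat -> seq Tt -> R) :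
  \sum_(y <- level n) mass h y * f (size y) (actv y) =
  eta_weight n * \sum_(s <- words token_alphabet n)
    (token_weight [::] s * \sum_(k <- fills Ct s) h k) * f (size s) (toks s).
Proof.
rewrite (eq_big_seq (fun y => eta_weight n * (wt [::] y * (h (sk y) * f n (toks (sk y)))))).
  rewrite -big_distrr /= (sum_level_tokens n [::] (fun k => h k * f n (toks k))).
  congr (_ * _); apply: eq_big_seq => s sin; rewrite Rmult_assoc big_distrl; congr (_ * _).
  have -> : size s = n.
    apply/eqP; rewrite -(mem_words (al := token_alphabet)) // => -[[[] t]|].
      by rewrite inE map_f ?orbT ?mem_enum.
    by rewrite mem_head.
  by apply: eq_big_seq => k /toks_fills ->.
by move=> y; rewrite mem_level toks_sk => /eqP <-; rewrite /mass; ring.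
Qed.

Lemma level_massE h n : level_mass (mass h) n =
  eta_weight n * \sum_(s <- words token_alphabet n)
    token_weight [::] s * \sum_(k <- fills Ct s) h k.
Proof.
have := sum_level_mass h n (fun _ _ => 1).
under eq_bigr do rewrite Rmult_1_r; rewrite /level_mass => ->; congr (_ * _).
by apply: eq_bigr => s _; rewrite Rmult_1_r.
Qed.

Lemma down_flowE h n : down_flow (mass h) n =
  eta_weight n * \sum_(s <- words token_alphabet n)
    (token_weight [::] s * \sum_(k <- fills Ct s) h k) * (eta (size s) * kfun sfun (toks s)).
Proof. exact: (sum_level_mass h n (fun m Ts => eta m * kfun sfun Ts)). Qed.

(** [level_crossing] asks for balance only in sum over each level, which sees [product_form] through
    [gw] alone; the balance at level 0 makes the constant vanish. *)
Lemma product_form_crossing n :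
  down_flow (mass product_form) n.+1 = total_rate * level_mass (mass product_form) n.
Proof.
have flowE m : \sum_(y <- level m) inflow (mass product_form) y =
    eta_weight m * \sum_(s <- words token_alphabet m)
      token_weight [::] s * (exit_rate s * gw s).
  rewrite (eq_big_seq (fun y => eta_weight m * (wt [::] y * state_flow product_form (sk y)))).
    rewrite -big_distrr /= sum_level_tokens; congr (_ * _); apply: eq_bigr => s _.
    case: (Req_dec (token_weight [::] s) 0) => [->|/token_weight_valid v]; first by ring.
    rewrite state_flow_fills -token_flow_gweight //; congr (_ * token_flow _ _).
    by apply: functional_extensionality => x; apply: sum_product_form.
  by move=> y; rewrite mem_level => /eqP <-; apply: inflow_mass.
rewrite (@level_crossing (mass product_form)) => [|m].
  have := flowE 0%N; rewrite !big_seq1 inflow_nil => ->.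
  by rewrite /mass /product_form /exit_rate /gweight /prodlam /eta_weight kfun_nil /=; ring.
rewrite flowE; under [RHS]eq_bigr do rewrite outrateE.
rewrite (sum_level_mass product_form m.+1 (fun i Ts => total_rate + eta i * kfun sfun Ts)).
by congr (_ * _); apply: eq_bigr => s _; rewrite sum_product_form /exit_rate; ring.
Qed.

(** The balance at the empty state, which the iteration does not provide, is inherited from [p]
    through the positive factor [p [::]]. *)
Lemma minimal_crossing n :
  down_flow (mass minimal) n.+1 = total_rate * level_mass (mass minimal) n.
Proof.
apply: (Rmult_eq_reg_l (p [::])); last exact/Rgt_not_eq/stationary_nil_gt0.
have := stationary_crossing n; rewrite /down_flow /level_mass.
under eq_bigr do rewrite stationary_minimal Rmult_assoc.
under [X in _ = _ * X]eq_bigr do rewrite stationary_minimal.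
by rewrite -!big_distrr /= => ->; ring.
Qed.

(** Induction on the length: agreement at length [n] gives equal masses of level [n], hence equal
    flows down from level [n.+1]. The differences there are nonnegative by [sum_minimal_le] and
    departure rates are positive, so each vanishes. The factor [token_weight] discards invalid
    sequences. *)
Lemma sum_minimal s :
  token_weight [::] s * \sum_(k <- fills Ct s) minimal k = token_weight [::] s * gw s.
Proof.
have term0 x : 0 <= token_weight [::] x * (gw x - \sum_(k <- fills Ct x) minimal k).
  case: (Req_dec (token_weight [::] x) 0) => [->|/token_weight_valid v].
    by rewrite Rmult_0_l; lra.
  apply: Rmult_le_pos; first exact: token_weight_ge0.
  by have := sum_minimal_le v; lra.
suff zero n x : x \in words token_alphabet n ->
    token_weight [::] x * (gw x - \sum_(k <- fills Ct x) minimal k) = 0.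
  have := zero (size s) s; rewrite mem_words ?eqxx => [/(_ isT)|o]; first by lra.
  by case: o => [[[] t]|]; rewrite inE // map_f ?orbT ?mem_enum.
elim: n x => [|n IH] x.
  by rewrite inE => /eqP ->; rewrite big_seq1 minimal_nil /gweight /prodlam /=; ring.
move=> xin.
have lm : level_mass (mass product_form) n = level_mass (mass minimal) n.
  rewrite !level_massE; congr (_ * _); apply: eq_big_seq => s' /IH e.
  by rewrite sum_product_form; lra.
have := product_form_crossing n; rewrite lm -minimal_crossing !down_flowE => df.
have {}df : \sum_(s <- words token_alphabet n.+1)
    (token_weight [::] s * (gw s - \sum_(k <- fills Ct s) minimal k)) *
    (eta (size s) * kfun sfun (toks s)) = 0.
  have E0 : eta_weight n.+1 <> 0 by apply/Rgt_not_eq/eta_weight_gt0.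
  apply: (Rmult_eq_reg_l (eta_weight n.+1)) => //; rewrite Rmult_0_r.
  move/(Rmult_eq_reg_l _ _ _)/(_ E0): df => df.
  under eq_bigr do rewrite Rmult_minus_distr_l Rmult_minus_distr_r -sum_product_form.
  by rewrite sumR_sub df; ring.
have ex : size x = n.+1.
  apply/eqP; rewrite -(mem_words (al := token_alphabet)) // => -[[[] t]|].
    by rewrite inE map_f ?orbT ?mem_enum.
  by rewrite mem_head.
have tz y : 0 <= (token_weight [::] y * (gw y - \sum_(k <- fills Ct y) minimal k)) *
    (eta (size y) * kfun sfun (toks y)).
  case: (Req_dec (token_weight [::] y) 0) => [->|/token_weight_valid v].
    by rewrite !Rmult_0_l; lra.
  apply: Rmult_le_pos => //; case: (eqVneq y [::]) => [->|ne].
    by rewrite kfun_nil; lra.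
  exact/Rlt_le/level_down_gt0.
have := sumR_eq0 (fun y _ => tz y) df xin => /Rmult_integral[] // e.
case: (Req_dec (token_weight [::] x) 0) => [->|/token_weight_valid v]; first by ring.
have ne : x != [::] by rewrite -size_eq0 ex.
by case: (Rgt_not_eq _ _ (level_down_gt0 v ne)).
Qed.

(** * Summing over the types of the customers *)

Definition unlabel (o : option (unit * Tt)) : option Tt := omap snd o.

Fixpoint fibre (s : seq (option (unit * Tt))) : seq (seq (Ct * option Tt)) :=
  if s is o :: s' then [seq (c, unlabel o) :: y | c <- enum Ct, y <- fibre s'] else [:: [::]].

Lemma mem_fibre s y : (y \in fibre s) = (strip (sk y) == s).
Proof.
elim: s y => [|o s IH] [|[c o'] y] //=.
  by apply/negbTE/negP => /allpairsP[[a b] []].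
apply/allpairsP/idP => [[[a b] /= [_ + [-> -> ->]]]|].
  by rewrite IH => /eqP <-; rewrite eqseq_cons eqxx andbT; case: o => [[[] t]|].
rewrite eqseq_cons => /andP[/eqP <- sy]; exists (c, y); rewrite /= mem_enum IH; split => //.
by case: o' => [t|].
Qed.

Lemma fibre_uniq s : uniq (fibre s).
Proof.
elim: s => //= o s IH; apply: allpairs_uniq; rewrite ?enum_uniq //.
by move=> [a b] [c d] _ _ /= [-> ->].
Qed.

Lemma sum_fibre s : forall pr H,
  \sum_(y <- fibre s) wt pr y * H (sk y) =
  token_weight pr s * \sum_(k <- fills Ct s) H k.
Proof.
elim: s => [|o s IH] pr H; first by rewrite !big_seq1.
rewrite big_allpairs_dep /=.
transitivity (\sum_(c <- enum Ct) weight1 lam Tc pr (c, unlabel o) *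
   (token_weight (pr ++ tok o) s * \sum_(k <- fills Ct s) H (skE (c, unlabel o) :: k))).
  apply: eq_bigr => c _; rewrite -(IH (pr ++ tok o) (fun k => H (skE (c, unlabel o) :: k))).
  rewrite big_distrr; apply: eq_bigr => y _; rewrite /= Rmult_assoc; congr (_ * (wt _ _ * _)).
  by case: o => [[u t]|].
case: o => [[u t]|] /=.
  rewrite sum_fills_cons /fill1 [in RHS]big_map cats1 Rmult_assoc [in RHS]big_distrr /=.
  by rewrite [in RHS]big_distrr.
rewrite sum_fills_cons big_seq1 cats0 lamUE Rmult_assoc big_distrl.
by apply: eq_bigr => c _.
Qed.

Section Generating.
Variable z : Ct -> Cx.

Definition holder_types (k : seq (option (Ct * Tt))) : seq Ct := pmap (omap fst) k.

Lemma hty_sk y : hty y = holder_types (sk y).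
Proof. by elim: y => //= -[c [t|]] y IH /=; rewrite -IH. Qed.

Lemma size_holder_types s k : k \in fills Ct s -> size (holder_types k) = size (toks s).
Proof.
move=> /toks_fills <-; elim: k => //= -[[c t]|] k IH //=; by rewrite IH.
Qed.

Definition waiting_sum (pr : seq Tt) : Cx := \big[Cadd/C0]_(c <- enum Ct)
  Cmul (RtoC (if Tc c \subset [set x in pr] then lam c else 0)) (z c).

Fixpoint waiting_weight (pr : seq Tt) (s : seq (option (unit * Tt))) : Cx :=
  match s with
  | [::] => C1
  | None :: s' => Cmul (waiting_sum pr) (waiting_weight pr s')
  | Some (_, t) :: s' => Cmul (RtoC (if t \in pr then 0 else 1)) (waiting_weight (rcons pr t) s')
  end.

(** Given the skeleton, waiting types are independent and factor out one by one; the holder types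
    stay coupled through [H]. *)
Lemma csum_fibre s : forall pr (H : seq (option (Ct * Tt)) -> Cx),
  \big[Cadd/C0]_(y <- fibre s)
     Cmul (Cmul (RtoC (wt pr y)) (H (sk y))) (\big[Cmul/C1]_(e <- y) z e.1) =
  Cmul (waiting_weight pr s) (\big[Cadd/C0]_(k <- fills Ct s)
     Cmul (H k) (\big[Cmul/C1]_(c <- holder_types k) z c)).
Proof.
elim: s => [|o s IH] pr H; first by rewrite !big_seq1 /= !big_nil -/C1; ring.
rewrite big_allpairs_dep /=.
transitivity (\big[Cadd/C0]_(c <- enum Ct)
   Cmul (Cmul (RtoC (weight1 lam Tc pr (c, unlabel o))) (z c))
   (Cmul (waiting_weight (pr ++ tok o) s) (\big[Cadd/C0]_(k <- fills Ct s)
     Cmul (H (skE (c, unlabel o) :: k)) (\big[Cmul/C1]_(c <- holder_types k) z c)))).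
  apply: eq_bigr => c _; rewrite -(IH (pr ++ tok o) (fun k => H (skE (c, unlabel o) :: k))).
  rewrite big_distrr; apply: eq_bigr => y _; rewrite /= RtoC_mul big_cons /=.
  have -> : pr ++ tok (skE (c, unlabel o)) = pr ++ tok o by case: (o) => [[u t]|].
  by ring.
rewrite fills_cons big_allpairs_dep; case: o => [[u t]|] /=.
  rewrite [in RHS]big_map cats1 [in RHS]big_distrr; apply: eq_bigr => c _ /=.
  rewrite [in RHS](eq_bigr (fun k => Cmul (z c) (Cmul (H (Some (c, t) :: k))
    (\big[Cmul/C1]_(c <- holder_types k) z c)))); last first.
    by move=> k _; rewrite big_cons; ring.
  rewrite -big_distrr /= -!Cmul_assoc; congr Cmul.
  by rewrite !Cmul_assoc (Cmul_comm (z c)).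
by rewrite big_seq1 cats0 /waiting_sum /skE /= -big_distrl /= -!Cmul_assoc.
Qed.

Lemma waiting_sumE (Ts : seq Tt) j : waiting_sum (take j Ts) =
  Cmul (RtoC (lamU lam Tc [set x in take j Ts]))
   (csum (enum Ct) (fun c => Cmul (RtoC (theta lam Tc Ts c j)) (z c))).
Proof.
rewrite /waiting_sum csumE big_distrr /=; apply: eq_bigr => c _.
rewrite Cmul_assoc -RtoC_mul; congr (Cmul (RtoC _) _); rewrite /theta.
(* If [lamU] vanishes, [theta] is 0 by convention, and every summand of [lamU] vanishes as well by
   nonnegativity. *)
case: Req_EM_T => [e|ne]; last by rewrite /Rdiv (Rmult_comm _ (/ _)) -Rmult_assoc Rinv_r ?Rmult_1_l.
rewrite Rmult_0_r; rewrite lamUE in e.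
apply: (sumR_eq0 _ e); last by rewrite mem_enum.
by move=> c' _; case: ifP => _; [have := lam_gt0 c'; lra | lra].
Qed.

(** * Aggregated states as token sequences; weights as products over blocks *)

Fixpoint expand (Ts : seq Tt) (ns : seq nat) : seq (option (unit * Tt)) :=
  match Ts, ns with
  | t :: Ts', n :: ns' => Some (tt, t) :: nseq n None ++ expand Ts' ns'
  | _, _ => [::]
  end.

Lemma expand_agg y : strip (sk y) = nseq (agg y).1 None ++
  expand (unzip1 (agg y).2) (unzip2 (agg y).2).
Proof. by elim: y => //= -[c [t|]] y IH /=; case: (agg y) IH => l bs /= ->. Qed.

Fixpoint agg_skeleton (s : seq (option (unit * Tt))) : nat * seq (Tt * nat) :=
  match s with
  | [::] => (0%N, [::])
  | o :: s' => let (l, bs) := agg_skeleton s' in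
               match o with Some (_, t) => (0%N, (t, l) :: bs) | None => (l.+1, bs) end
  end.

Lemma agg_strip y : agg y = agg_skeleton (strip (sk y)).
Proof. by elim: y => //= -[c [t|]] y /= ->. Qed.

Lemma agg_expand Ts ns : size ns = size Ts -> agg_skeleton (expand Ts ns) = (0%N, zip Ts ns).
Proof.
elim: Ts ns => [|t Ts IH] [|n ns] //= [/IH e].
suff -> : agg_skeleton (nseq n None ++ expand Ts ns) = (n, zip Ts ns) by [].
by elim: n => //= n ->.
Qed.

Lemma agg_eq Ts ns y : size ns = size Ts ->
  (agg y == (0%N, zip Ts ns)) = (strip (sk y) == expand Ts ns).
Proof.
move=> e; apply/eqP/eqP => h; last by rewrite agg_strip h agg_expand.
by rewrite expand_agg h /= unzip1_zip ?unzip2_zip ?e.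
Qed.

Lemma size_expand Ts ns : size ns = size Ts -> size (expand Ts ns) = (size Ts + sumn ns)%N.
Proof.
elim: Ts ns => [|t Ts IH] [|n ns] //= [/IH e].
by rewrite size_cat size_nseq e addSn addnCA.
Qed.

Lemma toks_expand Ts ns : size ns = size Ts -> toks (expand Ts ns) = Ts.
Proof.
elim: Ts ns => [|t Ts IH] [|n ns] //= [/IH e]; congr (_ :: _).
by rewrite toks_cat e; elim: n.
Qed.

(** Stated for any commutative monoid, with [iter] as power, so that it serves both the real weights
    and the complex [waiting_weight]. *)
Lemma block_product (A : Type) (one : A) (op : Monoid.com_law one)
    (a b : seq Tt -> A) (F : seq Tt -> seq (option (unit * Tt)) -> A) :
  (forall pr, F pr [::] = one) ->
  (forall pr t s, t \notin pr -> F pr (Some (tt, t) :: s) = op (a (rcons pr t)) (F (rcons pr t) s)) ->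
  (forall pr s, F pr (None :: s) = op (b pr) (F pr s)) ->
  forall Ts ns, uniq Ts -> size ns = size Ts ->
  F [::] (expand Ts ns) = \big[op/one]_(j <- iota 1 (size Ts))
     op (a (take j Ts)) (iter (nth 0%N ns j.-1) (op (b (take j Ts))) one).
Proof.
move=> F0 FS FN Ts ns; suff gen pr : uniq (pr ++ Ts) -> size ns = size Ts ->
  F pr (expand Ts ns) = \big[op/one]_(j <- iota 1 (size Ts))
     op (a (pr ++ take j Ts)) (iter (nth 0%N ns j.-1) (op (b (pr ++ take j Ts))) one).
  by move: (gen [::]).
elim: Ts ns pr => [|t Ts IH] [|n ns] pr u //= e; first by rewrite big_nil F0.
have tn : t \notin pr by move: u; rewrite cat_uniq /= negb_or => /and3P[_ /andP[]].
rewrite FS // big_cons /= take0 cats1 -Monoid.mulmA; congr (op _ _).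
rewrite (iotaDl 1 1) big_map.
have -> : F (rcons pr t) (nseq n None ++ expand Ts ns) =
    op (iter n (op (b (rcons pr t))) one) (F (rcons pr t) (expand Ts ns)).
  elim: n {e} => [|n IHn] /=; first by rewrite Monoid.mul1m.
  by rewrite FN IHn Monoid.mulmA.
congr (op _ _); rewrite IH; [|by rewrite cat_rcons | by case: e].
apply: eq_big_seq => j; rewrite mem_iota => /andP[j0 _].
by rewrite add1n /= cat_rcons; case: j j0.
Qed.

Lemma token_weight_expand Ts ns : uniq Ts -> size ns = size Ts ->
  token_weight [::] (expand Ts ns) = \big[Rmult/1]_(j <- iota 1 (size Ts))
    lamU lam Tc [set x in take j Ts] ^ nth 0%N ns j.-1.
Proof.
move=> u e; rewrite (@block_product _ _ Rmult (fun=> 1)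
   (fun pr => lamU lam Tc [set x in pr]) token_weight) //.
  apply: eq_bigr => j _; rewrite /= Rmult_1_l.
  by elim: (nth _ _ _) => //= n ->.
by move=> pr t s /negbTE /= ->.
Qed.

Lemma kweight_expand Ts ns : uniq Ts -> size ns = size Ts ->
  kweight [::] (expand Ts ns) = \big[Rmult/1]_(j <- iota 1 (size Ts))
    (/ kfun sfun (take j Ts) * (/ kfun sfun (take j Ts)) ^ nth 0%N ns j.-1).
Proof.
move=> u e; rewrite (@block_product _ _ Rmult (fun pr => / kfun sfun pr)
   (fun pr => / kfun sfun pr) kweight) //.
- apply: eq_bigr => j _; congr (_ * _).
  by elim: (nth _ _ _) => //= n ->.
- by move=> pr t s _; rewrite /= /Rdiv Rmult_comm.
- by move=> pr s; rewrite /= /Rdiv Rmult_comm.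
Qed.

Lemma waiting_weight_expand Ts ns : uniq Ts -> size ns = size Ts ->
  waiting_weight [::] (expand Ts ns) = \big[Cmul/C1]_(j <- iota 1 (size Ts))
    Cpow (waiting_sum (take j Ts)) (nth 0%N ns j.-1).
Proof.
move=> u e; rewrite (@block_product _ _ Cmul (fun=> C1) waiting_sum waiting_weight) //.
  apply: eq_bigr => j _; rewrite /= Cmul_1_l.
  by elim: (nth _ _ _) => //= n ->.
by move=> pr t s /negbTE /= ->.
Qed.

Lemma lhs_termE s : lhs_term p z s = Cmul (RtoC (p s)) (\big[Cmul/C1]_(e <- s) z e.1).
Proof.
rewrite /lhs_term cprodE; congr (Cmul _ _).
elim: s => [|e s IH]; first by rewrite big_nil big1.
rewrite big_cons -IH.
have E c : Cpow (z c) (Mc (e :: s) c) = Cmul (if c == e.1 then z c else C1) (Cpow (z c) (Mc s c)).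
  by rewrite /Mc /= eq_sym; case: eqP => _; rewrite ?add1n ?add0n //= Cmul_1_l.
rewrite (eq_bigr _ (fun c _ => E c)) big_split; congr (Cmul _ _).
rewrite (bigD1_seq e.1) ?mem_enum ?enum_uniq //= eqxx big1 ?Cmul_1_r; first by ring.
by move=> c /negbTE ->.
Qed.

(** * State probabilities and the conditional law of the holder types *)

Lemma Prob_fibre (E : seq (Ct * option Tt) -> bool) s :
  (forall y, E y -> strip (sk y) == s) ->
  Prob p E = \sum_(y <- fibre s) (if E y then p y else 0).
Proof.
move=> h; apply: Usum_Rser_val; apply: Usum_finite; first exact: fibre_uniq.
by move=> y; rewrite mem_fibre; case: ifP => // /h ->.
Qed.

Lemma size_strip (y : seq (Ct * option Tt)) : size (strip (sk y)) = size y.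
Proof. by rewrite !size_map. Qed.

Lemma stationary_fibre s y : y \in fibre s ->
  p y = p [::] * eta_weight (size s) * (wt [::] y * minimal (sk y)).
Proof.
by rewrite mem_fibre => /eqP <-; rewrite size_strip stationary_minimal /mass Rmult_assoc.
Qed.

Definition state_prob Ts ns : R := Prob p (fun s => agg s == (0%N, zip Ts ns)).
Definition types_prob (cs : seq Ct) Ts ns : R :=
  Prob p (fun s => (agg s == (0%N, zip Ts ns)) && (hty s == cs)).

Lemma state_prob_fibre Ts ns : size ns = size Ts ->
  state_prob Ts ns = \sum_(y <- fibre (expand Ts ns)) p y.
Proof.
move=> e; rewrite /state_prob (@Prob_fibre _ (expand Ts ns)).
  by apply: eq_big_seq => y; rewrite mem_fibre agg_eq // => ->.
by move=> y; rewrite agg_eq.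
Qed.

Lemma types_prob_fibre cs Ts ns : size ns = size Ts ->
  types_prob cs Ts ns = \sum_(y <- fibre (expand Ts ns)) (if hty y == cs then p y else 0).
Proof.
move=> e; rewrite /types_prob (@Prob_fibre _ (expand Ts ns)).
  by apply: eq_big_seq => y; rewrite mem_fibre agg_eq // => ->.
by move=> y; rewrite agg_eq // => /andP[].
Qed.

Lemma state_probE Ts ns : size ns = size Ts -> state_prob Ts ns =
  p [::] * eta_weight (size (expand Ts ns)) *
  (token_weight [::] (expand Ts ns) * gw (expand Ts ns)).
Proof.
move=> e; rewrite state_prob_fibre // (eq_big_seq _ (@stationary_fibre _)) -big_distrr /=.
by rewrite sum_fibre sum_minimal.
Qed.

Lemma types_probE cs Ts ns : size ns = size Ts -> types_prob cs Ts ns =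
  p [::] * eta_weight (size (expand Ts ns)) * (token_weight [::] (expand Ts ns) *
    \sum_(k <- fills Ct (expand Ts ns)) (if holder_types k == cs then minimal k else 0)).
Proof.
move=> e; rewrite types_prob_fibre // -sum_fibre big_distrr; apply: eq_big_seq => y yin /=.
by rewrite hty_sk; case: ifP => _; [apply: stationary_fibre | ring].
Qed.

Lemma types_prob_ge0 cs Ts ns : size ns = size Ts -> 0 <= types_prob cs Ts ns.
Proof.
move=> e; rewrite types_prob_fibre //; apply: sumR_ge0 => y _.
by case: ifP => _; [apply: stationary_ge0 | lra].
Qed.

Lemma types_prob_le cs Ts ns : size ns = size Ts -> types_prob cs Ts ns <= state_prob Ts ns.
Proof.
move=> e; rewrite types_prob_fibre // state_prob_fibre //; apply: sumR_le => y _.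
by case: ifP => _; [lra | apply: stationary_ge0].
Qed.

(** Holds also where conditioning is void: [Gcond] is then 0 by convention, and the joint
    probability is squeezed to 0. *)
Lemma Gcond_mul cs Ts ns : size ns = size Ts ->
  state_prob Ts ns * Gcond p cs Ts ns = types_prob cs Ts ns.
Proof.
move=> e; have := types_prob_ge0 cs e; have := types_prob_le cs e.
rewrite /Gcond -/(state_prob Ts ns) -/(types_prob cs Ts ns).
case: Req_EM_T => h le ge; last by rewrite /Rdiv Rmult_comm Rmult_assoc Rinv_l ?Rmult_1_r.
by rewrite Rmult_0_r; apply: Rle_antisym => //; rewrite -h.
Qed.

Definition types_gf Ts ns : Cx := csum (enum {: (size Ts).-tuple Ct})
  (fun cs => Cmul (RtoC (Gcond p (val cs) Ts ns)) (cprod (val cs) z)).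

(** After exchanging the sums, each typed skeleton contributes to exactly one tuple of types, its
    own. *)
Lemma types_gfE Ts ns : size ns = size Ts ->
  Cmul (RtoC (state_prob Ts ns)) (types_gf Ts ns) =
  Cmul (RtoC (p [::] * eta_weight (size (expand Ts ns)) * token_weight [::] (expand Ts ns)))
   (\big[Cadd/C0]_(k <- fills Ct (expand Ts ns))
     Cmul (RtoC (minimal k)) (\big[Cmul/C1]_(c <- holder_types k) z c)).
Proof.
move=> e; rewrite /types_gf csumE big_distrr /=.
under eq_bigr do rewrite Cmul_assoc -RtoC_mul Gcond_mul // types_probE // -Rmult_assoc RtoC_mul.
under eq_bigr do rewrite -Cmul_assoc RtoC_sum big_distrl /=.
rewrite -big_distrr exchange_big /=; congr (Cmul _ _); apply: eq_big_seq => k kin.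
have sz : size (holder_types k) == size Ts by rewrite (size_holder_types kin) toks_expand.
rewrite (bigD1_seq (Tuple sz)) ?mem_enum ?enum_uniq //= eqxx cprodE [X in Cadd _ X]big1.
  by rewrite Cadd_comm Cadd_0_l.
move=> cs ne; case: eqP => [h|_]; last by apply: Cmul_0_l.
by case/eqP: ne; apply: val_inj.
Qed.

Lemma lhs_fibre Ts ns : \big[Cadd/C0]_(y <- fibre (expand Ts ns)) lhs_term p z y =
  Cmul (RtoC (p [::] * eta_weight (size (expand Ts ns)))) (Cmul (waiting_weight [::] (expand Ts ns))
   (\big[Cadd/C0]_(k <- fills Ct (expand Ts ns))
     Cmul (RtoC (minimal k)) (\big[Cmul/C1]_(c <- holder_types k) z c))).
Proof.
rewrite -(csum_fibre _ _ (fun k => RtoC (minimal k))) big_distrr; apply: eq_big_seq => y yin /=.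
by rewrite lhs_termE (stationary_fibre yin) !RtoC_mul -!Cmul_assoc.
Qed.

Definition token_coef (Ts : seq Tt) : R := p [::] * prodlam lam assign Ts / PiK sfun Ts *
  rprod (iota 1 (size Ts)) (fun j => / eta j).

Lemma eta_weight_add i n :
  eta_weight (i + n) = eta_weight i * rprod (iota 1 n) (fun m => / eta (i + m)%N).
Proof.
rewrite /eta_weight !rprodE iotaD big_cat; congr (_ * _).
by rewrite addnC iotaDl big_map.
Qed.

Lemma prodR_pow X (s : seq X) (f g : X -> R) (n : X -> nat) :
  \big[Rmult/1]_(j <- s) (f j * g j) ^ n j =
  \big[Rmult/1]_(j <- s) f j ^ n j * \big[Rmult/1]_(j <- s) g j ^ n j.
Proof. by rewrite -big_split; apply: eq_bigr => j _; apply: Rpow_mult_distr. Qed.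

Lemma prodR_inv X (s : seq X) (f : X -> R) :
  \big[Rmult/1]_(j <- s) / f j = / \big[Rmult/1]_(j <- s) f j.
Proof.
by symmetry; apply: (big_morph Rinv) => [a b|]; [apply: Rinv_mult | apply: Rinv_1].
Qed.

Lemma state_prob_coef Ts ns : uniq Ts -> size ns = size Ts ->
  state_prob Ts ns = token_coef Ts * rprod (iota 1 (sumn ns)) (fun m => / eta (size Ts + m)%N) *
    \big[Rmult/1]_(j <- iota 1 (size Ts)) alpha lam Tc sfun Ts j ^ nth 0%N ns j.-1.
Proof.
move=> u e; rewrite state_probE // size_expand // eta_weight_add /gweight cat0s toks_expand //.
rewrite token_weight_expand // kweight_expand // big_split /= /alpha prodR_pow prodR_inv.
rewrite /token_coef /PiK [in RHS]rprodE /Rdiv -/(eta_weight (size Ts)).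
have shape (a b r A l K B : R) : a * (b * r) * (A * (l * (K * B))) = a * l * K * b * r * (A * B).
  by ring.
exact: shape.
Qed.

(** The powers of [alpha] complete the coefficient to the state probability, which turns the
    conditional law of the holders into a joint one; the powers of the [theta] sums are the
    generating function of the waiting customers. *)
Lemma inner_identity Ts ns : uniq Ts -> size ns = size Ts ->
  Cmul (RtoC (token_coef Ts)) (innerTerm lam Tc sfun eta p z Ts ns) =
  \big[Cadd/C0]_(y <- fibre (expand Ts ns)) lhs_term p z y.
Proof.
move=> u e; rewrite lhs_fibre waiting_weight_expand //.
under [X in Cmul _ (Cmul X _)]eq_bigr do rewrite waiting_sumE Cpow_mul -RtoC_pow.
rewrite big_split /= -RtoC_prod -token_weight_expand //.
rewrite /innerTerm -/(types_gf Ts ns) cprodE.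
under eq_bigr do rewrite Cpow_mul -RtoC_pow.
rewrite big_split /= -RtoC_prod.
set S := \big[Cmul/C1]_(j <- _) Cpow (csum _ _) _.
transitivity (Cmul (Cmul (RtoC (state_prob Ts ns)) (types_gf Ts ns)) S).
  have shape a A r x y : Cmul a (Cmul (Cmul A r) (Cmul x y)) = Cmul (Cmul (Cmul (Cmul a r) x) A) y.
    by ring.
  by rewrite state_prob_coef // !RtoC_mul; apply: shape.
have shape a w B y : Cmul (Cmul (Cmul a w) B) y = Cmul a (Cmul (Cmul w y) B) by ring.
by rewrite types_gfE // [RtoC (_ * token_weight _ _)]RtoC_mul; apply: shape.
Qed.

(** * Absolute convergence and summation over all states *)

Hypothesis z_lt1 : forall c, Cnorm (z c) < 1.

Lemma Cnorm_lhs s : Cnorm (lhs_term p z s) <= p s.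
Proof.
rewrite lhs_termE Cnorm_mul Cnorm_RtoC; last exact: stationary_ge0.
have := @Cnorm_prod _ s (fun e => z e.1) (fun e => Rlt_le _ _ (z_lt1 e.1)).
by have := stationary_ge0 s; nra.
Qed.

Lemma lhs_summable : Csummable (lhs_term p z).
Proof.
apply: (@Csummable_bound _ _ 1) => F u; apply: Rle_trans (stationary_mass1 u).
by apply: sumR_le => s _; apply: Cnorm_lhs.
Qed.

Lemma lhs_support s : lhs_term p z s <> C0 -> wt [::] s <> 0.
Proof.
move=> h w; apply: h; rewrite lhs_termE.
have -> : p s = 0 by case: (Req_dec (p s) 0) => // /stationary_weight; lra.
exact: Cmul_0_l.
Qed.

Definition select (Ts : seq Tt) (y : seq (Ct * option Tt)) : option ((size Ts).-tuple nat) :=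
  if ((agg y).1 == 0%N) && (unzip1 (agg y).2 == Ts) then insub (unzip2 (agg y).2) else None.

Lemma select_fibre Ts y (ns : (size Ts).-tuple nat) :
  (y \in fibre (expand Ts ns)) = (select Ts y == Some ns).
Proof.
rewrite mem_fibre -agg_eq ?size_tuple // /select.
apply/eqP/eqP => [->|] /=; first by rewrite unzip1_zip ?unzip2_zip ?size_tuple // eqxx valK.
case: ifP => // /andP[/eqP l /eqP e1]; case: insubP => // ns' _ e2 [<-].
by rewrite e2 -e1 zip_unzip -l; case: (agg y).
Qed.

Lemma selected_sum Ts : exists l,
  CUsum (fun y => if select Ts y is Some _ then lhs_term p z y else C0) l.
Proof.
apply: (@CUsum_dominated _ _ p 1) => [y|F u]; last exact: stationary_mass1.
by case: select => [ns|]; [apply: Cnorm_lhs | rewrite Cnorm_C0; apply: stationary_ge0].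
Qed.

Lemma selected_fibres Ts l : uniq Ts ->
  CUsum (fun y => if select Ts y is Some _ then lhs_term p z y else C0) l ->
  CUsum (fun ns : (size Ts).-tuple nat =>
    Cmul (RtoC (token_coef Ts)) (innerTerm lam Tc sfun eta p z Ts ns)) l.
Proof.
move=> u h.
have h2 : CUsum (fun ns : (size Ts).-tuple nat => \big[Cadd/C0]_(y <- fibre (expand Ts ns))
    if select Ts y is Some _ then lhs_term p z y else C0) l.
  apply: (CUsum_fibres (g := select Ts) (fib := fun ns : (size Ts).-tuple nat => fibre (expand Ts ns)) h).
  - by move=> y ->.
  - by move=> ns; apply: fibre_uniq.
  - by move=> y ns; apply: select_fibre.
apply: CUsum_ext h2 => ns; rewrite inner_identity ?size_tuple //; apply: eq_big_seq => y.
by rewrite select_fibre => /eqP ->.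
Qed.

Lemma PiK_gt0 Ts : uniq Ts -> 0 < PiK sfun Ts.
Proof.
move=> u; rewrite /PiK rprodE big_seq; apply: (big_ind (fun x => 0 < x)) => [||j]; first by lra.
  exact: Rmult_lt_0_compat.
rewrite mem_iota => /andP[j0 jn]; apply: kfun_gt0; first exact: take_uniq.
by case: j j0 jn => // j _; case: (Ts).
Qed.

Lemma token_coef_ge0 Ts : uniq Ts -> 0 <= token_coef Ts.
Proof.
move=> u; apply: Rmult_le_pos; last exact/Rlt_le/eta_weight_gt0.
apply: Rmult_le_pos; last exact/Rlt_le/Rinv_0_lt_compat/PiK_gt0.
by apply: Rmult_le_pos; [apply: stationary_ge0 | apply: prodlam_ge0].
Qed.

Lemma CUsum_C0 (A : countType) : CUsum (fun _ : A => C0) C0.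
Proof. by split; have := @Usum_finite A (fun=> 0) [::] isT (fun _ _ => erefl); rewrite big_nil. Qed.

Lemma selected_total Ts : uniq Ts ->
  CUsum (fun y => if select Ts y is Some _ then lhs_term p z y else C0)
    (Cmul (RtoC (token_coef Ts)) (innerSum lam Tc sfun eta p z Ts)).
Proof.
move=> u; have [l hl] := selected_sum Ts; have h := selected_fibres u hl.
suff -> : Cmul (RtoC (token_coef Ts)) (innerSum lam Tc sfun eta p z Ts) = l by [].
(* The value of [innerSum] is obtained by dividing by the coefficient. If that is 0, all terms of
   the scaled series vanish, so [l] is 0 too. *)
case: (Req_dec (token_coef Ts) 0) => [e|ne].
  rewrite e Cmul_0_l -(CUsum_Csum h) -[LHS](CUsum_Csum (CUsum_C0 ((size Ts).-tuple nat))).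
  by congr Csum; apply: functional_extensionality => ns; rewrite e Cmul_0_l.
have cancel x : Cmul (RtoC (/ token_coef Ts)) (Cmul (RtoC (token_coef Ts)) x) = x.
  by rewrite Cmul_assoc -RtoC_mul Rinv_l // Cmul_1_l.
have h2 : CUsum (fun ns : (size Ts).-tuple nat => innerTerm lam Tc sfun eta p z Ts ns)
    (Cmul (RtoC (/ token_coef Ts)) l).
  by apply: CUsum_ext (CUsum_scal (/ token_coef Ts) h) => ns; apply: cancel.
by rewrite /innerSum (CUsum_Csum h2) Cmul_assoc -RtoC_mul Rinv_r // Cmul_1_l.
Qed.

Lemma inner_summable Ts : uniq Ts ->
  Csummable (fun ns : (size Ts).-tuple nat => innerTerm lam Tc sfun eta p z Ts ns).
Proof.
move=> u; case: (Rle_lt_or_eq_dec _ _ (token_coef_ge0 u)) => [pos|zero]; last first.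
  (* With coefficient 0 every state probability is 0, so [Gcond] and with it every inner term is 0
     by convention. *)
  apply: (@Csummable_bound _ _ 0) => F _; rewrite big1; first by right.
  move=> ns _; rewrite /innerTerm csumE big1 ?Cmul_0_l ?Cnorm_C0 // => cs _.
  have e0 : state_prob Ts ns = 0 by rewrite state_prob_coef ?size_tuple // -zero; ring.
  by rewrite /Gcond -/(state_prob Ts ns) e0; case: Req_EM_T => [e|[]] //; apply: Cmul_0_l.
(* The fibres are disjoint, so [p] has mass at most 1 on them; the 2 comes from bounding a norm by
   its real and imaginary parts. *)
apply: (@Csummable_bound _ _ (/ token_coef Ts * 2)) => F uF.
have i0 : 0 < / token_coef Ts by apply: Rinv_0_lt_compat.
have ufl : uniq (flatten [seq fibre (expand Ts (val ns)) | ns : (size Ts).-tuple nat <- F]).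
  apply: (flatten_fibres_uniq (g := select Ts)) uF => [ns|y ns]; first exact: fibre_uniq.
  exact: select_fibre.
apply: Rle_trans (_ : / token_coef Ts * (2 * \sum_(ns <- F)
    \sum_(y <- fibre (expand Ts (val ns))) p y) <= _); last first.
  apply: Rmult_le_compat_l; first lra.
  have := stationary_mass1 ufl; rewrite big_flatten big_map /=; lra.
rewrite big_distrr big_distrr; apply: sumR_le => ns _ /=.
have -> : Cnorm (innerTerm lam Tc sfun eta p z Ts ns) = / token_coef Ts *
    Cnorm (\big[Cadd/C0]_(y <- fibre (expand Ts ns)) lhs_term p z y).
  rewrite -inner_identity ?size_tuple // Cnorm_mul Cnorm_RtoC; last lra.
  by rewrite -Rmult_assoc Rinv_l ?Rmult_1_l //; lra.
apply: Rmult_le_compat_l; first lra.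
apply: Rle_trans (Cnorm_le _) _; rewrite fst_csum snd_csum.
have le1 (f : Cx -> R) : (forall a, Rabs (f a) <= Cnorm a) ->
    Rabs (\sum_(y <- fibre (expand Ts ns)) f (lhs_term p z y)) <=
    \sum_(y <- fibre (expand Ts ns)) p y.
  move=> hf; apply: Rle_trans (sumR_abs _ _) _; apply: sumR_le => y _.
  exact: Rle_trans (hf _) (Cnorm_lhs y).
have := le1 fst fst_le_Cnorm; have := le1 snd snd_le_Cnorm.
move: (\sum_(y <- _) p y) => P h1 h2.
have -> : 2 * P = P + P by ring.
exact: Rplus_le_compat.
Qed.

Notation tuples i := (filter (@uniq Tt) (map (fun Ts : i.-tuple Tt => val Ts) (enum {: i.-tuple Tt}))).

Lemma mem_tuples i Ts : (Ts \in tuples i) = uniq Ts && (size Ts == i).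
Proof.
rewrite mem_filter; case: (uniq Ts) => //=; apply/mapP/eqP => [[t _ ->]|e].
  exact: size_tuple.
by exists (Tuple (introT eqP e)); rewrite ?mem_enum.
Qed.

Lemma tuples_uniq i : uniq (tuples i).
Proof. by rewrite filter_uniq // map_inj_uniq ?enum_uniq //; apply: val_inj. Qed.

Lemma unzip1_agg (y : seq (Ct * option Tt)) : unzip1 (agg y).2 = actv y.
Proof. by elim: y => //= -[c [t|]] y /=; case: (agg y) => l bs /= ->. Qed.

Lemma agg_valid (y : seq (Ct * option Tt)) : valid [::] (sk y) -> (agg y).1 = 0%N.
Proof. by case: y => [|[c [t|]] y] //=; case: (agg y). Qed.

Lemma csum_pick (X : eqType) (s : seq X) (a : X) (v : Cx) : uniq s ->
  \big[Cadd/C0]_(x <- s) (if x == a then v else C0) = if a \in s then v else C0.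
Proof.
move=> u; case: ifP => [i|n].
  rewrite (bigD1_seq a) //= eqxx big1 ?Cadd_0_r; last by move=> x /negbTE ->.
  by rewrite Cadd_comm Cadd_0_l.
by rewrite big1_seq // => x /andP[_ xs]; case: eqP => // e; rewrite -e xs in n.
Qed.

(** A state with nonzero term is selected by exactly one tuple, [actv y], whose distinct tokens
    number at most [#|Tt|]. *)
Lemma lhs_decomposition y : lhs_term p z y =
  \big[Cadd/C0]_(i <- iota 0 #|Tt|.+1) \big[Cadd/C0]_(Ts <- tuples i)
    (if select Ts y is Some _ then lhs_term p z y else C0).
Proof.
case: (classic (lhs_term p z y = C0)) => [->|/lhs_support w].
  by rewrite big1 // => i _; rewrite big1 // => Ts _; case: select.
have u := weight_uniq w; have a0 := agg_valid (weight_valid w).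
have E Ts : (if select Ts y is Some _ then lhs_term p z y else C0) =
    if Ts == actv y then lhs_term p z y else C0.
  rewrite /select a0 /= unzip1_agg eq_sym; case: eqP => // e.
  case: insubP => // /negP[]; apply/eqP.
  by rewrite e -(unzip1_agg y) /unzip1 /unzip2 !size_map.
under eq_bigr do under eq_bigr do rewrite E.
under eq_bigr do rewrite csum_pick ?tuples_uniq // mem_tuples u /= eq_sym.
rewrite csum_pick ?iota_uniq // mem_iota /= add0n ltnS.
by rewrite -(card_uniqP u) max_card.
Qed.

Lemma generating_function : Chas_sum (lhs_term p z) (rhs lam Tc assign sfun eta p z).
Proof.
apply: CUsum_has_sum lhs_summable _; rewrite /rhs csumE.
apply: CUsum_ext (fun y => esym (lhs_decomposition y)) _.
apply: CUsum_bigsum => i _; rewrite csumE; apply: CUsum_bigsum => Ts.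
rewrite mem_tuples => /andP[u /eqP <-]; exact: selected_total.
Qed.

End Generating.
End Stationary.

End Queue.

Theorem mainTheorem4 (Ct Tt : finType) (lam : Ct -> R) (Tc : Ct -> {set Tt})
  (assign : Ct -> {set Tt} -> Tt -> R) (sfun : seq Tt -> R) (eta : nat -> R)
  (p : @dstate Ct Tt -> R) (z : Ct -> Cx) :
  (forall c, 0 < lam c) ->
  (forall c, Tc c != set0) ->
  assign_rule Tc assign ->
  assignment_condition lam assign ->
  order_independent sfun eta ->
  stationary lam Tc assign sfun eta p ->
  (forall c, Cnorm (z c) < 1) ->
  (forall Ts : seq Tt, uniq Ts ->
     Csummable (fun ns : (size Ts).-tuple nat => innerTerm lam Tc sfun eta p z Ts ns)) /\
  Chas_sum (lhs_term p z) (rhs lam Tc assign sfun eta p z).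
Proof.
move=> lam_gt0 Tc_neq0 rule assignC orderI st z_lt1; split.
  exact: (inner_summable lam_gt0 Tc_neq0 rule assignC orderI st z_lt1).
exact: (generating_function lam_gt0 Tc_neq0 rule assignC orderI st z_lt1).
Qed.
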